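(* Let $0\le\lambda<\gamma\le\delta$. Then the equation $$r+8(\gamma-\lambda)\sum_{m=2}^{\infty}\frac{r^m}{m^2[2\gamma+(\delta-\gamma)(m-1)]}-1-4(\gamma-\lambda)\sum_{m=2}^{\infty}\frac{(-1)^{m-1}}{m^2[2\gamma+(\delta-\gamma)(m-1)]}=0$$ has a unique root $R_1(\gamma,\delta,\lambda)$ in $(0,1)$, and for every $f=h+\overline{g}\in R_H^0(\gamma,\delta,\lambda)$, $$|f(z)|+\sum_{m=2}^{\infty}(|a_m|+|b_m|)|z|^m\le d(f(0),\partial f(\mathbb{D}))$$ for $|z|=r\le R_1(\gamma,\delta,\lambda)$. The radius $R_1(\gamma,\delta,\lambda)$ is the best possible.
   Context: $\mathbb{D}$ is the open unit disk in $\mathbb{C}$. $\mathcal{H}_0$ is the set of complex-valued harmonic functions $f=h+\overline{g}$ on $\mathbb{D}$ with $h,g$ analytic, $h(0)=h'(0)-1=0$, $g(0)=g'(0)=0$; write $h(z)=z+\sum_{m=2}^\infty a_mz^m$, $g(z)=\sum_{m=2}^\infty b_mz^m$. For $0\le\lambda<\gamma\le\delta$, $R_H^0(\gamma,\delta,\lambda)$ is the class of all $f=h+\overline{g}\in\mathcal{H}_0$ satisfying, for all $z\in\mathbb{D}$, $$\mathrm{Re}\left(\gamma h'(z)+\delta zh''(z)+\tfrac{\delta-\gamma}{2}z^2h'''(z)-\lambda\right)>\left|\gamma g'(z)+\delta zg''(z)+\tfrac{\delta-\gamma}{2}z^2g'''(z)\right|.$$ $d(f(0),\partial f(\mathbb{D}))$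 is the Euclidean distance from $f(0)$ to the boundary of $f(\mathbb{D})$. A radius being the best possible means that it cannot be replaced by any larger number in such a way that the inequality still holds for all functions in the class. *)

(* Defs.v *)
From Stdlib Require Import Reals.
From Coquelicot Require Import Coquelicot.
Open Scope R_scope.

Definition in_disk (z : C) : Prop := Cmod z < 1.

Definition analytic_on_disk (h : C -> C) : Prop :=
  forall z : C, in_disk z -> @ex_derive C_AbsRing C_NormedModule h z.

Definition harm (h g : C -> C) (z : C) : C := (h z + Cconj (g z))%C.

(* The class H_0, as a condition on the pair (h, g): the normalization
   g(0) = 0 makes the decomposition f = harm h g unique on the disk. *)
Definition H0 (h g : C -> C) : Prop :=
  analytic_on_disk h /\ analytic_on_disk g /\
  h (RtoC 0) = RtoC 0 /\ (C_derive h (RtoC 0) - RtoC 1)%C = RtoC 0 /\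
  g (RtoC 0) = RtoC 0 /\ C_derive g (RtoC 0) = RtoC 0.

(* C_derive is a total operator; on an analytic function it is the complex
   derivative, so its iterates below are h', h'', h''' on the disk. *)
Definition diff_op (gam del : R) (h : C -> C) (z : C) : C :=
  (RtoC gam * C_derive h z
   + RtoC del * z * C_derive (C_derive h) z
   + RtoC ((del - gam) / 2) * z ^ 2 * C_derive (C_derive (C_derive h)) z)%C.

Definition RH0 (gam del lam : R) (h g : C -> C) : Prop :=
  H0 h g /\
  forall z : C, in_disk z ->
    Re (diff_op gam del h z - RtoC lam)%C > Cmod (diff_op gam del g z).

(* F z = sum_{m >= 2} c_m z^m on the disk; the values c_0, c_1 are unused. *)
Definition expansion_from2 (c : nat -> C) (F : C -> C) : Prop :=
  forall z : C, in_disk z ->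
    @is_series C_AbsRing C_NormedModule
      (fun k : nat => (c (k + 2)%nat * z ^ (k + 2))%C) (F z).

Definition coefficients (h g : C -> C) (a b : nat -> C) : Prop :=
  expansion_from2 a (fun z : C => (h z - z)%C) /\ expansion_from2 b g.

(* sum_{m >= 2} u_m *)
Definition Series_from2 (u : nat -> R) : R :=
  Series (fun k : nat => u (k + 2)%nat).

Definition image_disk (f : C -> C) (w : C) : Prop :=
  exists z : C, in_disk z /\ w = f z.

(* In the closure of S and not in its interior. *)
Definition boundary (S : C -> Prop) (w : C) : Prop :=
  ~ @locally C_UniformSpace w (fun u : C => ~ S u) /\
  ~ @locally C_UniformSpace w S.

(* Infimum in the extended reals: p_infty when S is empty. *)
Definition dist_to (p : C) (S : C -> Prop) : Rbar :=
  Glb_Rbar (fun d : R => exists w : C, S w /\ d = Cmod (w - p)%C).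

Definition denom (gam del : R) (m : nat) : R :=
  INR m ^ 2 * (2 * gam + (del - gam) * (INR m - 1)).

Definition radius_equation (gam del lam r : R) : Prop :=
  r + 8 * (gam - lam) * Series_from2 (fun m : nat => r ^ m / denom gam del m)
  - 1
  - 4 * (gam - lam)
      * Series_from2 (fun m : nat => (-1) ^ (m - 1) / denom gam del m) = 0.

(* The coefficient series converges, since power series converge absolutely
   inside the disk; Series is thus its genuine sum. *)
Definition bohr_inequality (h g : C -> C) (a b : nat -> C) (z : C) : Prop :=
  Rbar_le
    (Finite (Cmod (harm h g z)
       + Series_from2 (fun m : nat => (Cmod (a m) + Cmod (b m)) * Cmod z ^ m)))
    (dist_to (harm h g (RtoC 0)) (boundary (image_disk (harm h g)))).

Definition bohr_holds_upto (gam del lam rho : R) : Prop :=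
  forall (h g : C -> C) (a b : nat -> C),
    RH0 gam del lam h g -> coefficients h g a b ->
    forall z : C, in_disk z -> Cmod z <= rho -> bohr_inequality h g a b z.

(* Main.v *)
Require Import Defs.
From Stdlib Require Import Reals Lra Lia ClassicalEpsilon.
From Coquelicot Require Import Coquelicot.
Open Scope R_scope.

(** Put [T(z) = gam h' + del z h'' + (del - gam) / 2 z^2 h'''].  On monomials it
    acts by [z^(n+1) |-> w_n z^n] with
    [w_n = (n + 1)^2 (gam + (del - gam) / 2 n) = denom (n + 1) / 2], so it is, up
    to the shift of degree, a product of three first order Euler operators
    [alpha + beta z d/dz] with [alpha > 0] and [beta >= 0].

    For a unimodular [e] the function [p = T(h) - lam + e T(g)] is analytic with
    positive real part and [p(0) = gam - lam].  Two classical facts about such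
    functions carry the proof, both obtained by testing [Re p] against a
    nonnegative trigonometric polynomial and averaging over roots of unity
    ([positive_real_part_kernel]).  Caratheodory's bound gives
    [|a_m| + |b_m| <= E_(m-1) = 4 (gam - lam) / denom m] once [e] is chosen to
    align the two terms.  Harnack's inequality gives
    [Re p >= (gam - lam) (1 - r) / (1 + r)], that is, [Re p(z)] is at least the
    value at [- |z|] of the function attached to the extremal
    [h0(z) = z + sum E_(m-1) z^m] ([extremal_fun]).

    To pass from [p] back to [h + e g] one inverts the three Euler operators
    along a ray.  Each of them obeys a minimum principle ([euler_minimum]):
    a lower bound on [alpha G + beta r G'] is one on [alpha G], as seen at a
    minimum of [G].  Applied to [(h + e g) / z] minus the extremal series this
    yields [|f(z)| >= |h| - |g| >= - h0(- |z|)]; applied to [h' + e g'] it yields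
    [Re h' > |g'|].

    Hence no boundary point of [f(D)] is closer to the origin than
    [d* = - h0(- 1)]: near the unit circle [|f|] is almost [d*], so a missed value
    [u] of smaller modulus which is close to the image would have its nearest
    value at an interior point, where [|h'| > |g'|] lets one move closer to [u]
    ([boundary_far]).  Together with the coefficient bounds, the Bohr inequality
    follows wherever [V(r) = r + 2 sum E_(m-1) r^m <= d*].  The equation of the
    radius is [V(r) = d*]; [V] increases, and [0 < d* <= 1 < V(r)] for some
    [r < 1], because the alternating series defining [d*] starts with
    [1 - E_1], where [E_1 < 1].

    For sharpness take [f = h0], whose left-hand side at [z = r] is exactly
    [V(r)].  The point [- d*] is the limit of [h0(- r)], and [h0] omits it: since
    [Re h0' > 0], the function [h0] is monotone along chords, so it is real only
    on the real axis, where it increases from [- d*].  Thus [- d*] is a boundary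
    point and the distance to the boundary is at most [d*]. *)

(** * Complex numbers *)

Lemma C_eq (z w : C) : Re z = Re w -> Im z = Im w -> z = w.
Proof. destruct z, w; simpl; intros; subst; reflexivity. Qed.

Lemma Re_le_Cmod (z : C) : Re z <= Cmod z.
Proof. pose proof (re_le_Cmod z). pose proof (Rle_abs (Re z)). lra. Qed.

Lemma Im_le_Cmod (z : C) : Rabs (Im z) <= Cmod z.
Proof.
  pose proof (Rmax_Cmod z). pose proof (Rmax_r (Rabs (fst z)) (Rabs (snd z))).
  unfold Im; lra.
Qed.

Lemma Cmod_R_nonneg (x : R) : 0 <= x -> Cmod (RtoC x) = x.
Proof. intros; rewrite Cmod_R; apply Rabs_pos_eq; auto. Qed.

Lemma Cmod_triangle_minus (z w : C) : Cmod (z - w) <= Cmod z + Cmod w.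
Proof. unfold Cminus. rewrite <- (Cmod_opp w). apply Cmod_triangle. Qed.

Lemma Cmod_triangle_rev (z w : C) : Cmod z - Cmod w <= Cmod (z + w).
Proof.
  pose proof (Cmod_triangle_minus (z + w) w).
  replace (z + w - w)%C with z in H by ring. lra.
Qed.

Lemma Cmod_minus_sym (z w : C) : Cmod (z - w) = Cmod (w - z).
Proof. rewrite <- Cmod_opp. f_equal. ring. Qed.

Lemma Cplus_minus_cancel (z w : C) : (z + (w - z))%C = w.
Proof. ring. Qed.

(** * Absolutely convergent complex series *)

Definition CSeries (a : nat -> C) : C :=
  (Series (fun n => Re (a n)), Series (fun n => Im (a n))).

Definition abs_summable (a : nat -> C) : Prop :=
  ex_series (fun n => Cmod (a n)).

Lemma ex_series_bound (u v : nat -> R) :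
  (forall n, Rabs (u n) <= v n) -> ex_series v -> ex_series u.
Proof. intros H; apply @ex_series_le; exact H. Qed.

Lemma Series_nonneg (u : nat -> R) :
  (forall n, 0 <= u n) -> ex_series u -> 0 <= Series u.
Proof.
  intros H Hu. replace 0 with (Series (fun n => 0 * u n)).
  - apply Series_le; auto. intros n; specialize (H n); lra.
  - rewrite Series_scal_l; ring.
Qed.

Lemma abs_summable_Re a : abs_summable a -> ex_series (fun n => Re (a n)).
Proof. apply ex_series_bound; intros; apply re_le_Cmod. Qed.

Lemma abs_summable_Im a : abs_summable a -> ex_series (fun n => Im (a n)).
Proof. apply ex_series_bound; intros; apply Im_le_Cmod. Qed.

Lemma abs_summable_le a (v : nat -> R) :
  (forall n, Cmod (a n) <= v n) -> ex_series v -> abs_summable a.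
Proof.
  intros H; apply ex_series_bound; intros n.
  rewrite Rabs_pos_eq; [apply H | apply Cmod_ge_0].
Qed.

Lemma abs_summable_scal k a :
  abs_summable a -> abs_summable (fun n => (k * a n)%C).
Proof.
  intros Ha. eapply abs_summable_le.
  - intros n; rewrite Cmod_mult; apply Rle_refl.
  - exact (ex_series_scal (Cmod k) _ Ha).
Qed.

Lemma abs_summable_shift a :
  abs_summable a <-> abs_summable (fun n => a (S n)).
Proof. apply (ex_series_incr_1 (fun n => Cmod (a n))). Qed.

Lemma CSeries_ext a b : (forall n, a n = b n) -> CSeries a = CSeries b.
Proof.
  intros H; unfold CSeries; f_equal; apply Series_ext; intros; rewrite H; auto.
Qed.

Lemma CSeries_plus a b : abs_summable a -> abs_summable b ->
  CSeries (fun n => (a n + b n)%C) = (CSeries a + CSeries b)%C.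
Proof.
  intros Ha Hb; apply C_eq; simpl; rewrite <- Series_plus;
    auto using abs_summable_Re, abs_summable_Im.
Qed.

Lemma CSeries_scal k a : abs_summable a ->
  CSeries (fun n => (k * a n)%C) = (k * CSeries a)%C.
Proof.
  intros Ha. pose proof (abs_summable_Re _ Ha). pose proof (abs_summable_Im _ Ha).
  assert (E : forall x (u : nat -> R), ex_series u -> ex_series (fun n => x * u n))
    by (intros x u Hu; exact (ex_series_scal x u Hu)).
  apply C_eq; simpl.
  - rewrite <- !Series_scal_l, <- Series_minus by auto. reflexivity.
  - rewrite <- !Series_scal_l, <- Series_plus by auto. reflexivity.
Qed.

Lemma CSeries_minus a b : abs_summable a -> abs_summable b ->
  CSeries (fun n => (a n - b n)%C) = (CSeries a - CSeries b)%C.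
Proof.
  intros Ha Hb.
  rewrite (CSeries_ext _ (fun n => (a n + (- RtoC 1) * b n)%C)) by (intros; ring).
  rewrite CSeries_plus, CSeries_scal by auto using abs_summable_scal. ring.
Qed.

Lemma CSeries_shift a : abs_summable a ->
  CSeries a = (a 0%nat + CSeries (fun n => a (S n)))%C.
Proof.
  intros Ha; apply C_eq; simpl; rewrite Series_incr_1 at 1;
    auto using abs_summable_Re, abs_summable_Im.
Qed.

(** Pairing the sum with its own conjugate turns the complex triangle
    inequality into a comparison of two real series. *)
Lemma CSeries_mod a : abs_summable a ->
  Cmod (CSeries a) <= Series (fun n => Cmod (a n)).
Proof.
  intros Ha. set (s := CSeries a).
  assert (Hs : Cmod s * Cmod s <= Cmod s * Series (fun n => Cmod (a n))).
  { replace (Cmod s * Cmod s) with (Re (Cconj s * s)).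
    - unfold s at 2. rewrite <- CSeries_scal by auto. simpl.
      rewrite <- Series_scal_l.
      assert (Hk : ex_series (fun n => Cmod s * Cmod (a n)))
        by exact (ex_series_scal (Cmod s) _ Ha).
      eapply Rle_trans; [apply Rle_abs|].
      eapply Rle_trans; [apply Series_Rabs|].
      + apply ex_series_bound with (2 := Hk); intros n.
        rewrite Rabs_Rabsolu. rewrite <- (Cmod_conj s), <- Cmod_mult.
        apply (re_le_Cmod (Cconj s * a n)%C).
      + apply Series_le; auto. intros n; split; [apply Rabs_pos|].
        rewrite <- (Cmod_conj s), <- Cmod_mult.
        apply (re_le_Cmod (Cconj s * a n)%C).
    - replace (Cmod s * Cmod s) with (Cmod s ^ 2) by ring.
      rewrite Cmod2_alt; simpl; unfold Re, Im; ring. }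
  destruct (Rle_lt_or_eq_dec 0 (Cmod s) (Cmod_ge_0 s)) as [Hp|Hz].
  - apply Rmult_le_reg_l with (Cmod s); auto.
  - rewrite <- Hz. apply Series_nonneg; auto using Cmod_ge_0.
Qed.

Lemma sum_n_Re_Im (a : nat -> C) n :
  @sum_n C_NormedModule a n
  = (sum_n (fun k => Re (a k)) n, sum_n (fun k => Im (a k)) n).
Proof.
  induction n.
  - rewrite !sum_O. destruct (a 0%nat); reflexivity.
  - rewrite !sum_Sn, IHn. reflexivity.
Qed.

Lemma is_series_C_iff (a : nat -> C) (l : C) :
  @is_series C_AbsRing C_NormedModule a l <->
  is_series (fun n => Re (a n)) (Re l) /\ is_series (fun n => Im (a n)) (Im l).
Proof.
  split.
  - intros H; split; unfold is_series in *.
    + apply (filterlim_ext (fun n => fst (@sum_n C_NormedModule a n))).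
      { intros n; rewrite sum_n_Re_Im; reflexivity. }
      eapply filterlim_comp; [exact H|]. apply continuous_fst.
    + apply (filterlim_ext (fun n => snd (@sum_n C_NormedModule a n))).
      { intros n; rewrite sum_n_Re_Im; reflexivity. }
      eapply filterlim_comp; [exact H|]. apply continuous_snd.
  - intros [H1 H2]. unfold is_series in *.
    apply (proj2 (filterlim_locally (U := C_UniformSpace) _ _)). intros eps.
    generalize (filter_and _ _ (proj1 (filterlim_locally _ _) H1 eps)
                               (proj1 (filterlim_locally _ _) H2 eps)).
    apply filter_imp. intros n [A B].
    rewrite sum_n_Re_Im. split; assumption.
Qed.

Lemma CSeries_correct a : abs_summable a ->
  @is_series C_AbsRing C_NormedModule a (CSeries a).
Proof.
  intros Ha; apply is_series_C_iff; split; simpl; apply Series_correct;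
    auto using abs_summable_Re, abs_summable_Im.
Qed.

Lemma is_series_C_unique a l :
  @is_series C_AbsRing C_NormedModule a l -> CSeries a = l.
Proof.
  intros H; apply is_series_C_iff in H as [H1 H2].
  apply C_eq; simpl; apply is_series_unique; assumption.
Qed.

(** * Complex power series on the unit disk *)

Definition PS (c : nat -> C) (z : C) : C := CSeries (fun n => (c n * z ^ n)%C).

Definition cv_disk (c : nat -> C) : Prop :=
  forall r, 0 <= r < 1 -> ex_series (fun n => Cmod (c n) * r ^ n).

Definition dcoef (c : nat -> C) (n : nat) : C := (RtoC (INR (S n)) * c (S n))%C.

Lemma cv_disk_summable c z : cv_disk c -> Cmod z < 1 ->
  abs_summable (fun n => (c n * z ^ n)%C).
Proof.
  intros Hc Hz. eapply abs_summable_le.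
  - intros n. rewrite Cmod_mult, Cmod_pow. apply Rle_refl.
  - apply Hc. split; [apply Cmod_ge_0 | auto].
Qed.

(** Bounded terms at a point closer to the circle give a geometric majorant. *)
Lemma cv_disk_of_bounded (c : nat -> C) :
  (forall r, 0 < r < 1 -> exists M, forall n, Cmod (c n) * r ^ n <= M) ->
  cv_disk c.
Proof.
  intros H r [Hr0 Hr1]. set (s := (r + 1) / 2).
  assert (0 < s < 1) by (unfold s; lra).
  destruct (H s) as [M HM]; auto.
  apply ex_series_bound with (v := fun n => M * (r / s) ^ n).
  - intros n. rewrite Rabs_pos_eq.
    2:{ apply Rmult_le_pos; [apply Cmod_ge_0 | apply pow_le; auto]. }
    replace (r ^ n) with (s ^ n * (r / s) ^ n).
    2:{ rewrite <- Rpow_mult_distr. f_equal. field. lra. }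
    rewrite <- Rmult_assoc. apply Rmult_le_compat_r; auto.
    apply pow_le. apply Rdiv_le_0_compat; lra.
  - apply (ex_series_scal M (fun n => (r / s) ^ n)). apply ex_series_geom.
    rewrite Rabs_pos_eq by (apply Rdiv_le_0_compat; lra).
    apply Rmult_lt_reg_r with s; [lra|].
    unfold Rdiv. rewrite Rmult_assoc, Rinv_l by lra. unfold s; lra.
Qed.

Lemma cv_disk_radius (c : nat -> C) (A : nat -> R) :
  cv_disk c -> (forall n, Rabs (A n) <= Cmod (c n)) ->
  Rbar_le 1 (CV_radius A).
Proof.
  intros Hc HA. apply Rbar_not_lt_le. intros Hlt.
  destruct (CV_radius_bounded A) as [Hub _].
  assert (H0 := CV_radius_ge_0 A).
  destruct (CV_radius A) as [x| |]; simpl in *; try tauto.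
  set (s := (x + 1) / 2).
  assert (Hs : 0 <= s < 1) by (unfold s; lra).
  assert (s <= x); [|unfold s in *; lra].
  apply (Hub s).
  assert (Hex := Hc s Hs). apply ex_series_lim_0 in Hex.
  destruct (filterlim_bounded _ (ex_intro _ 0 Hex)) as [M HM].
  exists M. intros n. eapply Rle_trans; [|apply HM].
  unfold norm; simpl; unfold abs; simpl.
  rewrite !Rabs_mult. apply Rmult_le_compat_r; [apply Rabs_pos|].
  rewrite (Rabs_pos_eq (Cmod _)) by apply Cmod_ge_0. apply HA.
Qed.

Lemma cv_disk_dcoef c : cv_disk c -> cv_disk (dcoef c).
Proof.
  intros Hc r Hr.
  assert (H1 : Rbar_le 1 (CV_radius (PS_derive (fun n => Cmod (c n))))).
  { rewrite CV_radius_derive. apply (cv_disk_radius c); auto. intros n.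
    rewrite Rabs_pos_eq; [lra | apply Cmod_ge_0]. }
  eapply ex_series_ext; [|apply (CV_disk_inside (PS_derive (fun n => Cmod (c n))) r)].
  - intros n; simpl. unfold PS_derive, dcoef.
    rewrite Rabs_pos_eq, Cmod_mult, Cmod_R_nonneg; auto using pos_INR.
    apply Rmult_le_pos; [|apply pow_le; lra].
    apply Rmult_le_pos; [apply pos_INR|apply Cmod_ge_0].
  - apply Rbar_lt_le_trans with 1; auto. simpl. rewrite Rabs_pos_eq; lra.
Qed.

Lemma cv_disk_shift c : cv_disk c -> cv_disk (fun n => c (S n)).
Proof.
  intros Hc. apply cv_disk_of_bounded. intros r Hr.
  assert (Hex := Hc r ltac:(lra)). apply ex_series_lim_0 in Hex.
  destruct (filterlim_bounded _ (ex_intro _ 0 Hex)) as [M HM].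
  exists (M / r). intros n.
  specialize (HM (S n)). unfold norm in HM; simpl in HM; unfold abs in HM; simpl in HM.
  pose proof (Rle_abs (Cmod (c (S n)) * (r * r ^ n))).
  apply Rmult_le_reg_r with r; [lra|].
  unfold Rdiv. rewrite (Rmult_assoc M), Rinv_l, Rmult_1_r by lra. 
  replace (Cmod (c (S n)) * r ^ n * r) with (Cmod (c (S n)) * (r * r ^ n)) by ring.
  lra.
Qed.

Lemma cv_disk_plus c d : cv_disk c -> cv_disk d -> cv_disk (fun n => (c n + d n)%C).
Proof.
  intros Hc Hd r Hr.
  apply ex_series_bound with (2 := ex_series_plus _ _ (Hc r Hr) (Hd r Hr)).
  intros n. unfold plus; simpl. pose proof (pow_le r n (proj1 Hr)).
  rewrite Rabs_pos_eq; [|apply Rmult_le_pos; auto; apply Cmod_ge_0].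
  rewrite <- Rmult_plus_distr_r. apply Rmult_le_compat_r; auto. apply Cmod_triangle.
Qed.

Lemma cv_disk_scal k c : cv_disk c -> cv_disk (fun n => (k * c n)%C).
Proof.
  intros Hc r Hr.
  eapply ex_series_ext; [|exact (ex_series_scal (Cmod k) _ (Hc r Hr))].
  intros n. unfold scal; simpl; unfold mult; simpl. rewrite Cmod_mult. ring.
Qed.

Lemma PS_plus_coef c d z : cv_disk c -> cv_disk d -> Cmod z < 1 ->
  PS (fun n => (c n + d n)%C) z = (PS c z + PS d z)%C.
Proof.
  intros Hc Hd Hz. unfold PS. rewrite <- CSeries_plus by auto using cv_disk_summable.
  apply CSeries_ext; intros; ring.
Qed.

Lemma PS_scal_coef k c z : cv_disk c -> Cmod z < 1 ->
  PS (fun n => (k * c n)%C) z = (k * PS c z)%C.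
Proof.
  intros Hc Hz. unfold PS. rewrite <- CSeries_scal by auto using cv_disk_summable.
  apply CSeries_ext; intros; ring.
Qed.

Lemma PS_shift c z : cv_disk c -> Cmod z < 1 ->
  PS c z = (c 0%nat + z * PS (fun n => c (S n)) z)%C.
Proof.
  intros Hc Hz. unfold PS.
  rewrite CSeries_shift by auto using cv_disk_summable.
  rewrite <- CSeries_scal by (apply (cv_disk_summable (fun n => c (S n)));
                              auto using cv_disk_shift).
  f_equal; [simpl; ring|]. apply CSeries_ext; intros; simpl; ring.
Qed.

Lemma PS_mod c z : cv_disk c -> Cmod z < 1 ->
  Cmod (PS c z) <= Series (fun n => Cmod (c n) * Cmod z ^ n).
Proof.
  intros Hc Hz. eapply Rle_trans; [apply CSeries_mod; auto using cv_disk_summable|].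
  apply Req_le, Series_ext. intros. rewrite Cmod_mult, Cmod_pow. auto.
Qed.

(** The remainder [E_n] of the binomial expansion satisfies
    [E_(n+1) = (z + w) E_n + n z^(n-1) w^2], so its size is controlled by the
    second derivative of the monomial. *)
Lemma Cpow_second_order n z w rho : Cmod z <= rho -> Cmod (z + w) <= rho ->
  Cmod ((z + w) ^ (S (S n)) - z ^ (S (S n))
        - RtoC (INR (S (S n))) * z ^ (S n) * w)
  <= INR (S (S n)) * INR (S n) * rho ^ n * Cmod w ^ 2.
Proof.
  intros Hz Hzw. assert (Hrho : 0 <= rho) by (pose proof (Cmod_ge_0 z); lra).
  induction n.
  - replace ((z + w) ^ 2 - z ^ 2 - RtoC (INR 2) * z ^ 1 * w)%C with (w ^ 2)%C
      by (simpl INR; replace (RtoC (1 + 1)) with (RtoC 1 + RtoC 1)%C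
            by (rewrite RtoC_plus; auto); ring).
    rewrite Cmod_pow. simpl. pose proof (pow2_ge_0 (Cmod w)). simpl in *. lra.
  - set (E := ((z + w) ^ S (S n) - z ^ S (S n)
               - RtoC (INR (S (S n))) * z ^ S n * w)%C) in *.
    replace ((z + w) ^ S (S (S n)) - z ^ S (S (S n)) -
             RtoC (INR (S (S (S n)))) * z ^ S (S n) * w)%C
      with ((z + w) * E + RtoC (INR (S (S n))) * z ^ S n * w ^ 2)%C.
    2:{ unfold E. rewrite (S_INR (S (S n))), RtoC_plus.
        rewrite !Cpow_S. ring. }
    eapply Rle_trans; [apply Cmod_triangle|].
    rewrite !Cmod_mult, !Cmod_pow, Cmod_R_nonneg by apply pos_INR.
    assert (A : Cmod (z + w) * Cmod E
                <= rho * (INR (S (S n)) * INR (S n) * rho ^ n * Cmod w ^ 2))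
      by (apply Rmult_le_compat; auto using Cmod_ge_0).
    assert (B : INR (S (S n)) * Cmod z ^ S n * Cmod w ^ 2
                <= INR (S (S n)) * rho ^ S n * Cmod w ^ 2).
    { apply Rmult_le_compat_r; [apply pow2_ge_0|].
      apply Rmult_le_compat_l; [apply pos_INR|].
      apply pow_incr; split; auto; apply Cmod_ge_0. }
    assert (D : 0 <= INR (S (S n)) * rho ^ S n * Cmod w ^ 2).
    { apply Rmult_le_pos; [|apply pow2_ge_0].
      apply Rmult_le_pos; [apply pos_INR|apply pow_le; auto]. }
    rewrite (S_INR (S (S n))).
    set (T := INR (S (S n)) * rho ^ S n * Cmod w ^ 2) in *.
    replace ((INR (S (S n)) + 1) * INR (S (S n)) * rho ^ S n * Cmod w ^ 2)
      with ((INR (S (S n)) + 1) * T) by (unfold T; ring).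
    replace (rho * (INR (S (S n)) * INR (S n) * rho ^ n * Cmod w ^ 2)) with
      (INR (S n) * T) in A by (unfold T; simpl; ring).
    assert (K : INR (S (S n)) = INR (S n) + 1) by apply S_INR.
    rewrite K. clearbody T. nra.
Qed.

(** Differentiability and continuity of analytic functions are all read off
    this uniform second order expansion. *)
Lemma PS_second_order c rho : cv_disk c -> 0 <= rho < 1 ->
  exists M, 0 <= M /\ forall z w, Cmod z <= rho -> Cmod (z + w) <= rho ->
    Cmod (PS c (z + w) - PS c z - PS (dcoef c) z * w) <= M * Cmod w ^ 2.
Proof.
  intros Hc Hrho.
  assert (Hd := cv_disk_dcoef _ Hc). assert (Hdd := cv_disk_dcoef _ Hd).
  set (u := fun n => Cmod (dcoef (dcoef c) n) * rho ^ n).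
  assert (Hu : ex_series u) by (apply Hdd; auto).
  exists (Series u). split.
  { apply Series_nonneg; auto. intros n. apply Rmult_le_pos; [apply Cmod_ge_0 | apply pow_le; lra]. }
  intros z w Hz Hzw.
  assert (Hz1 : Cmod z < 1) by lra. assert (Hzw1 : Cmod (z + w) < 1) by lra.
  set (e := fun n => (c (S (S n)) * ((z + w) ^ (S (S n)) - z ^ (S (S n))
        - RtoC (INR (S (S n))) * z ^ (S n) * w))%C).
  assert (He : forall n, Cmod (e n) <= Cmod w ^ 2 * u n).
  { intros n. unfold e. rewrite Cmod_mult.
    eapply Rle_trans; [apply Rmult_le_compat_l;
      [apply Cmod_ge_0 | apply (Cpow_second_order n z w rho); auto]|].
    unfold u, dcoef. rewrite !Cmod_mult, !Cmod_R_nonneg by apply pos_INR.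
    apply Req_le; ring. }
  assert (Hex : ex_series (fun n => Cmod w ^ 2 * u n))
    by exact (ex_series_scal (Cmod w ^ 2) u Hu).
  replace (PS c (z + w) - PS c z - PS (dcoef c) z * w)%C with (CSeries e).
  - eapply Rle_trans; [apply CSeries_mod; exact (abs_summable_le _ _ He Hex)|].
    rewrite Rmult_comm, <- Series_scal_l. apply Series_le; auto.
    intros n; split; auto using Cmod_ge_0.
  - assert (S1 : forall x, Cmod x < 1 -> PS c x = (c 0%nat + c 1%nat * x
                + CSeries (fun n => c (S (S n)) * x ^ (S (S n))))%C).
    { intros x Hx. unfold PS. assert (A := cv_disk_summable c x Hc Hx).
      rewrite CSeries_shift by auto. apply (proj1 (abs_summable_shift _)) in A.
      rewrite CSeries_shift by auto. simpl; ring. }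
    rewrite !S1 by auto. unfold PS at 1.
    assert (A := cv_disk_summable _ z Hd Hz1).
    rewrite (CSeries_shift (fun n => (dcoef c n * z ^ n)%C)) by auto. apply (proj1 (abs_summable_shift _)) in A.
    assert (Bz := cv_disk_summable c z Hc Hz1).
    apply (proj1 (abs_summable_shift _)) in Bz. apply (proj1 (abs_summable_shift _)) in Bz.
    assert (Bw := cv_disk_summable c (z + w)%C Hc Hzw1).
    apply (proj1 (abs_summable_shift _)) in Bw. apply (proj1 (abs_summable_shift _)) in Bw.
    rewrite (CSeries_ext e (fun n => (c (S (S n)) * (z + w) ^ (S (S n))
         - c (S (S n)) * z ^ (S (S n)))
         - w * (dcoef c (S n) * z ^ (S n)))%C) by
      (intros n; unfold e, dcoef; ring).
    rewrite CSeries_minus, CSeries_minus, CSeries_scal; auto.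
    + unfold dcoef. simpl (INR 1). simpl (z ^ 0)%C. ring.
    + eapply abs_summable_le; [intros; apply Cmod_triangle_minus|].
      exact (ex_series_plus _ _ Bw Bz).
    + apply abs_summable_scal; auto.
Qed.

Lemma is_derive_of_second_order (f : C -> C) (z l : C) M d : 0 < d -> 0 <= M ->
  (forall w, Cmod w < d -> Cmod (f (z + w)%C - f z - l * w) <= M * Cmod w ^ 2) ->
  @is_derive C_AbsRing C_NormedModule f z l.
Proof.
  intros Hd HM H. split.
  - apply @is_linear_scal_l.
  - intros x Hx.
    apply (is_filter_lim_locally_unique (V := AbsRing_NormedModule C_AbsRing)) in Hx.
    subst x. intros eps.
    assert (Hm : 0 < Rmin d (eps / (M + 1))).
    { apply Rmin_pos; auto. apply Rdiv_lt_0_compat; [apply eps | lra]. }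
    exists (mkposreal _ Hm). intros y Hy.
    change (Cmod (y - z) < Rmin d (eps / (M + 1))) in Hy.
    change (Cmod ((f y - f z) - ((y - z) * l)) <= eps * Cmod (y - z)).
    assert (Hy1 : Cmod (y - z) < d) by (pose proof (Rmin_l d (eps / (M + 1))); lra).
    assert (Hy2 : Cmod (y - z) < eps / (M + 1))
      by (pose proof (Rmin_r d (eps / (M + 1))); lra).
    specialize (H (y - z)%C Hy1).
    rewrite Cplus_minus_cancel in H. rewrite (Cmult_comm (y - z) l).
    eapply Rle_trans; [exact H|]. simpl. rewrite Rmult_1_r, <- Rmult_assoc.
    apply Rmult_le_compat_r; [apply Cmod_ge_0|].
    apply (Rmult_lt_compat_r (M + 1)) in Hy2; [|lra].
    unfold Rdiv in Hy2. rewrite Rmult_assoc, Rinv_l, Rmult_1_r in Hy2 by lra.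
    pose proof (Cmod_ge_0 (y - z)). nra.
Qed.

Lemma PS_is_derive c z : cv_disk c -> Cmod z < 1 ->
  @is_derive C_AbsRing C_NormedModule (PS c) z (PS (dcoef c) z).
Proof.
  intros Hc Hz. pose proof (Cmod_ge_0 z).
  destruct (PS_second_order c ((1 + Cmod z) / 2) Hc) as [M [HM H1]]; [lra|].
  apply (is_derive_of_second_order _ _ _ M ((1 - Cmod z) / 2)); [lra|auto|].
  intros w Hw. apply H1; [lra|]. pose proof (Cmod_triangle z w). lra.
Qed.

(** A derivative only sees the germ of a function, and the disk is open. *)
Lemma is_derive_ext_disk (f g : C -> C) (z l : C) :
  (forall x, Cmod x < 1 -> f x = g x) -> Cmod z < 1 ->
  @is_derive C_AbsRing C_NormedModule f z l ->
  @is_derive C_AbsRing C_NormedModule g z l.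
Proof.
  intros Hfg Hz. apply @is_derive_ext_loc.
  assert (Hp : 0 < 1 - Cmod z) by lra.
  exists (mkposreal _ Hp). intros y Hy. apply Hfg.
  change (Cmod (y - z) < 1 - Cmod z) in Hy.
  pose proof (Cmod_triangle z (y - z)) as Ht. rewrite Cplus_minus_cancel in Ht. lra.
Qed.

Lemma C_derive_PS (f : C -> C) c : cv_disk c ->
  (forall x, Cmod x < 1 -> f x = PS c x) ->
  forall z, Cmod z < 1 -> C_derive f z = PS (dcoef c) z.
Proof.
  intros Hc Hf z Hz. apply is_C_derive_unique.
  apply (is_derive_ext_disk (PS c)); auto using PS_is_derive.
  intros; symmetry; auto.
Qed.

(** * Averages over roots of unity *)

Fixpoint Csum (f : nat -> C) (n : nat) : C :=
  match n with O => RtoC 0 | S n => (Csum f n + f n)%C end.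

Lemma Csum_ext f g n : (forall k, (k < n)%nat -> f k = g k) -> Csum f n = Csum g n.
Proof.
  induction n; intros H; simpl; auto. rewrite IHn by auto. rewrite H; auto.
Qed.

Lemma Csum_scal c f n : Csum (fun k => (c * f k)%C) n = (c * Csum f n)%C.
Proof. induction n; simpl; [ring | rewrite IHn; ring]. Qed.

Lemma Csum_plus f g n : Csum (fun k => (f k + g k)%C) n = (Csum f n + Csum g n)%C.
Proof. induction n; simpl; [ring | rewrite IHn; ring]. Qed.

Lemma Csum_zero n : Csum (fun _ => RtoC 0) n = RtoC 0.
Proof. induction n; simpl; [auto | rewrite IHn; ring]. Qed.

Lemma Csum_exchange (F : nat -> nat -> C) m n :
  Csum (fun i => Csum (fun j => F i j) n) m = Csum (fun j => Csum (fun i => F i j) m) n.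
Proof.
  induction m; simpl; [rewrite Csum_zero; auto|].
  rewrite IHm, Csum_plus. auto.
Qed.

Lemma Csum_single f n i : (i < n)%nat ->
  (forall k, (k < n)%nat -> k <> i -> f k = RtoC 0) -> Csum f n = f i.
Proof.
  induction n; intros Hi H; [lia|]. simpl.
  destruct (Nat.eq_dec i n) as [->|Hne].
  - rewrite (Csum_ext f (fun _ => RtoC 0)), Csum_zero by (intros; apply H; lia). ring.
  - rewrite IHn by (auto; lia). rewrite (H n) by lia. ring.
Qed.

Lemma Csum_conj f n : Cconj (Csum f n) = Csum (fun k => Cconj (f k)) n.
Proof.
  induction n; simpl; [apply C_eq; simpl; ring|]. rewrite Cplus_conj, IHn. auto.
Qed.

Lemma Csum_Re_le f g n : (forall k, (k < n)%nat -> Re (f k) <= Re (g k)) ->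
  Re (Csum f n) <= Re (Csum g n).
Proof.
  induction n; intros H; [simpl; lra|]. 
  change (Re (Csum f n) + Re (f n) <= Re (Csum g n) + Re (g n)).
  apply Rplus_le_compat; auto.
Qed.

Lemma Csum_geom x n : ((x - 1) * Csum (fun k => x ^ k) n = x ^ n - 1)%C.
Proof.
  induction n; [simpl; ring|].
  change (Csum (fun k => (x ^ k)%C) (S n)) with (Csum (fun k => (x ^ k)%C) n + x ^ n)%C.
  rewrite Cmult_plus_distr_l, IHn. rewrite Cpow_S. ring.
Qed.

Definition cis (x : R) : C := (cos x, sin x).

Lemma cis_pow x n : (cis x ^ n)%C = cis (INR n * x).
Proof.
  induction n.
  - simpl. unfold cis. rewrite Rmult_0_l, cos_0, sin_0. auto.
  - rewrite Cpow_S, IHn, S_INR, Rmult_plus_distr_r, Rmult_1_l, Rplus_comm.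
    unfold cis. rewrite cos_plus, sin_plus. unfold Cmult; simpl.
    f_equal; ring.
Qed.

Lemma Cmod_cis x : Cmod (cis x) = 1.
Proof.
  unfold Cmod, cis; simpl. transitivity (sqrt 1); [f_equal | apply sqrt_1].
  pose proof (sin2_cos2 x). unfold Rsqr in H. lra.
Qed.

Lemma cis_neq_1 x : 0 < x < 2 * PI -> cis x <> RtoC 1.
Proof.
  intros Hx H. apply (f_equal Re) in H. simpl in H.
  assert (E : cos x = 1 - 2 * sin (x / 2) * sin (x / 2)).
  { rewrite <- cos_2a_sin. f_equal. lra. }
  assert (0 < sin (x / 2)) by (apply sin_gt_0; lra). nra.
Qed.

Definition root_avg (N : nat) (F : C -> C) : C :=
  (RtoC (/ INR N) * Csum (fun k => F (cis (2 * PI / INR N) ^ k)%C) N)%C.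

Lemma root_unit N k : Cmod (cis (2 * PI / INR N) ^ k) = 1.
Proof. rewrite Cmod_pow, Cmod_cis. apply pow1. Qed.

Lemma root_avg_ext N F G : (forall w, Cmod w = 1 -> F w = G w) ->
  root_avg N F = root_avg N G.
Proof.
  intros H. unfold root_avg. f_equal. apply Csum_ext; intros; apply H, root_unit.
Qed.

Lemma root_avg_Re_le N F G : (forall w, Cmod w = 1 -> Re (F w) <= Re (G w)) ->
  Re (root_avg N F) <= Re (root_avg N G).
Proof.
  intros H. unfold root_avg. rewrite !re_scal_l.
  apply Rmult_le_compat_l.
  - destruct N; [simpl; rewrite Rinv_0; lra|].
    apply Rlt_le, Rinv_0_lt_compat, lt_0_INR; lia.
  - apply Csum_Re_le; intros; apply H, root_unit.
Qed.

Lemma root_avg_scal N c F : root_avg N (fun w => c * F w)%C = (c * root_avg N F)%C.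
Proof. unfold root_avg. rewrite Csum_scal. ring. Qed.

Lemma root_avg_plus N F G :
  root_avg N (fun w => F w + G w)%C = (root_avg N F + root_avg N G)%C.
Proof. unfold root_avg. rewrite Csum_plus. ring. Qed.

Lemma root_avg_sum N F n : root_avg N (fun w => Csum (fun j => F j w) n)
  = Csum (fun j => root_avg N (F j)) n.
Proof. unfold root_avg. rewrite Csum_exchange, Csum_scal. auto. Qed.

Lemma root_avg_conj N F : root_avg N (fun w => Cconj (F w)) = Cconj (root_avg N F).
Proof.
  unfold root_avg. rewrite Cmult_conj, Csum_conj. f_equal.
  apply C_eq; simpl; ring.
Qed.

Lemma root_avg_pow N m : (0 < m < N)%nat -> root_avg N (fun w => w ^ m)%C = RtoC 0.
Proof.
  intros Hm. unfold root_avg.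
  set (x := (cis (2 * PI / INR N) ^ m)%C).
  assert (HN : 0 < INR N) by (apply lt_0_INR; lia).
  assert (Hm1 : 0 < INR m) by (apply lt_0_INR; lia).
  assert (Hm2 : INR m < INR N) by (apply lt_INR; lia).
  rewrite (Csum_ext _ (fun k => x ^ k)%C).
  2:{ intros k _. unfold x. rewrite <- !Cpow_mult_r. f_equal. lia. }
  assert (Hx : (x - 1)%C <> RtoC 0).
  { intros E. apply (cis_neq_1 (INR m * (2 * PI / INR N))).
    - pose proof PI_RGT_0. split.
      + apply Rmult_lt_0_compat; auto. apply Rdiv_lt_0_compat; lra.
      + replace (INR m * (2 * PI / INR N)) with (2 * PI * (INR m / INR N)) by (field; lra).
        rewrite <- (Rmult_1_r (2 * PI)) at 2. apply Rmult_lt_compat_l; [lra|].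
        apply Rmult_lt_reg_r with (INR N); auto. 
        unfold Rdiv. rewrite Rmult_assoc, Rinv_l; lra.
    - rewrite <- cis_pow. fold x.
      replace x with ((x - 1) + 1)%C by ring. rewrite E. ring. }
  assert (Hg := Csum_geom x N).
  replace (x ^ N)%C with (RtoC 1) in Hg.
  2:{ unfold x. rewrite <- Cpow_mult_r, Nat.mul_comm, Cpow_mult_r, cis_pow.
      replace (INR N * (2 * PI / INR N)) with (2 * PI) by (field; lra).
      unfold cis. rewrite cos_2PI, sin_2PI. rewrite Cpow_1_l. auto. }
  replace (Csum (fun k => (x ^ k)%C) N) with (RtoC 0); [ring|].
  replace (Csum (fun k => (x ^ k)%C) N)
    with (/ (x - 1) * ((x - 1) * Csum (fun k => x ^ k) N))%C.
  - rewrite Hg. field. auto.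
  - field. auto.
Qed.

Lemma root_avg_const N c : (0 < N)%nat -> root_avg N (fun _ => c) = c.
Proof.
  intros HN. unfold root_avg.
  assert (E : forall n, Csum (fun _ => c) n = (RtoC (INR n) * c)%C).
  { induction n; [simpl; ring|]. rewrite S_INR, RtoC_plus. simpl. rewrite IHn. ring. }
  rewrite E. assert (INR N <> 0) by (apply not_0_INR; lia).
  rewrite RtoC_inv by auto. field. intros H1; apply RtoC_inj in H1; auto.
Qed.

Lemma unit_conj w : Cmod w = 1 -> (w * Cconj w)%C = RtoC 1.
Proof. intros H. rewrite <- Cmod2_conj, H. f_equal. ring. Qed.

(** On the unit circle [conj w] inverts [w], and [i, j < N] keeps [i - j] from
    being a nonzero multiple of [N]. *)
Lemma root_avg_orth N i j : (i < N)%nat -> (j < N)%nat ->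
  root_avg N (fun w => w ^ i * Cconj w ^ j)%C = if Nat.eq_dec i j then RtoC 1 else RtoC 0.
Proof.
  intros Hi Hj.
  assert (E : forall w m n, Cmod w = 1 -> (w ^ (m + n) * Cconj w ^ n)%C = (w ^ m)%C).
  { intros w m n Hw. rewrite Cpow_add_r, <- Cmult_assoc, <- Cpow_mult_l, unit_conj by auto.
    rewrite Cpow_1_l. ring. }
  destruct (Nat.eq_dec i j) as [->|Hne].
  - rewrite (root_avg_ext _ _ (fun _ => RtoC 1)).
    + apply root_avg_const; lia.
    + intros w Hw. apply (E w 0%nat j Hw).
  - destruct (Nat.le_gt_cases i j).
    + rewrite (root_avg_ext _ _ (fun w => Cconj (w ^ (j - i))%C)).
      * rewrite root_avg_conj, root_avg_pow by lia. apply C_eq; simpl; ring.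
      * intros w Hw. replace j with ((j - i) + i)%nat at 1 by lia.
        rewrite Cpow_conj. rewrite <- (E (Cconj w) (j - i)%nat i) by (rewrite Cmod_conj; auto).
        rewrite Cconj_conj. ring.
    + rewrite (root_avg_ext _ _ (fun w => (w ^ (i - j))%C)).
      * apply root_avg_pow; lia.
      * intros w Hw. replace i with ((i - j) + j)%nat at 1 by lia. auto.
Qed.

(** The trigonometric polynomials [Re Q] and [Re K] satisfy
    [2 Re Q Re K = Re (Q K + conj Q K)], and averaging the two products over
    [2 J] points leaves the diagonal, respectively the constant terms. *)
Lemma trig_poly_positivity J (q k : nat -> C) kappa : (0 < J)%nat ->
  (forall w, Cmod w = 1 -> 0 <= Re (Csum (fun j => q j * w ^ j)%C J)) ->
  (forall w, Cmod w = 1 -> kappa <= Re (Csum (fun j => k j * Cconj w ^ j)%C J)) ->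
  2 * kappa * Re (q 0%nat)
  <= Re (Csum (fun j => q j * k j)%C J + Cconj (q 0%nat) * k 0%nat)%C.
Proof.
  intros HJ HQ HK.
  set (Q := fun w => Csum (fun j => q j * w ^ j)%C J) in *.
  set (K := fun w => Csum (fun j => k j * Cconj w ^ j)%C J) in *.
  set (N := (2 * J)%nat).
  assert (HQ0 : root_avg N Q = q 0%nat).
  { unfold Q. rewrite root_avg_sum.
    rewrite (Csum_single _ _ 0%nat) by
      (auto; intros; rewrite root_avg_scal, root_avg_pow by (unfold N; lia); ring).
    rewrite root_avg_scal. simpl. rewrite root_avg_const by (unfold N; lia). ring. }
  assert (HQK : root_avg N (fun w => Q w * K w)%C = Csum (fun j => q j * k j)%C J).
  { rewrite (root_avg_ext _ _ (fun w => Csum (fun i => q i *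
       Csum (fun j => k j * (w ^ i * Cconj w ^ j)) J) J)%C).
    2:{ intros w _. unfold Q, K.
        rewrite Cmult_comm, <- Csum_scal. apply Csum_ext; intros i _.
        rewrite Cmult_comm, <- Cmult_assoc, <- Csum_scal. f_equal.
        apply Csum_ext; intros; ring. }
    rewrite root_avg_sum. apply Csum_ext; intros i Hi.
    rewrite root_avg_scal, root_avg_sum. f_equal.
    rewrite (Csum_single _ _ i) by
     (auto; intros j Hj1 Hj2; rewrite root_avg_scal, root_avg_orth by (unfold N; lia);
      (destruct (Nat.eq_dec i j); [congruence|ring])).
    rewrite root_avg_scal, root_avg_orth by (unfold N; lia).
    destruct (Nat.eq_dec i i); [ring|congruence]. }
  assert (HcQK : root_avg N (fun w => Cconj (Q w) * K w)%C = (Cconj (q 0%nat) * k 0%nat)%C).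
  { rewrite (root_avg_ext _ _ (fun w => Csum (fun i => Cconj (q i) *
       Csum (fun j => k j * Cconj (w ^ (i + j))) J) J)%C).
    2:{ intros w _. unfold Q, K. rewrite Csum_conj.
        rewrite Cmult_comm, <- Csum_scal. apply Csum_ext; intros i _.
        rewrite Cmult_conj, Cmult_comm, <- Cmult_assoc, <- Csum_scal. f_equal.
        apply Csum_ext; intros. rewrite Cpow_add_r, Cmult_conj, !Cpow_conj. ring. }
    rewrite root_avg_sum.
    assert (Z : forall i j, (i < J)%nat -> (j < J)%nat -> (0 < i + j)%nat ->
      root_avg N (fun w => k j * Cconj (w ^ (i + j)))%C = RtoC 0).
    { intros i j Hi Hj Hij. rewrite root_avg_scal, root_avg_conj, root_avg_pow
        by (unfold N; lia). apply C_eq; simpl; ring. }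
    rewrite (Csum_single _ _ 0%nat HJ).
    - rewrite root_avg_scal, root_avg_sum. f_equal.
      rewrite (Csum_single _ _ 0%nat HJ) by (intros; apply Z; lia).
      rewrite root_avg_scal, root_avg_conj. simpl.
      rewrite root_avg_const by (unfold N; lia). apply C_eq; unfold Re, Im; simpl; ring.
    - intros i Hi Hi0. rewrite root_avg_scal, root_avg_sum.
      rewrite (Csum_ext _ (fun _ => RtoC 0)) by (intros; apply Z; lia).
      rewrite Csum_zero; ring. }
  rewrite <- HQK, <- HcQK, <- root_avg_plus.
  replace (2 * kappa * Re (q 0%nat)) with (Re (root_avg N (fun w => RtoC (2 * kappa) * Q w)%C))
    by (rewrite root_avg_scal, HQ0, re_scal_l; ring).
  apply root_avg_Re_le. intros w Hw. specialize (HQ w Hw); specialize (HK w Hw).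
  fold (Q w) in HQ. fold (K w) in HK. rewrite re_scal_l.
  replace (Re (Q w * K w + Cconj (Q w) * K w)%C) with (2 * (Re (Q w) * Re (K w)))
    by (simpl; unfold Re; ring).
  nra.
Qed.

(** * Holomorphic functions with positive real part *)

Lemma CSeries_Csum a J : abs_summable a ->
  CSeries a = (Csum a J + CSeries (fun n => a (J + n)%nat))%C /\
  abs_summable (fun n => a (J + n)%nat).
Proof.
  intros Ha. induction J; simpl.
  - split; [rewrite Cplus_0_l; auto | exact Ha].
  - destruct IHJ as [E1 E2]. split.
    + rewrite E1, CSeries_shift by auto. rewrite Nat.add_0_r.
      rewrite (CSeries_ext (fun n => a (J + S n)%nat) (fun n => a (S (J + n))))
        by (intros; f_equal; lia). ring.
    + apply (proj1 (abs_summable_shift _)) in E2.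
      eapply ex_series_ext; [|exact E2]. intros n; simpl. f_equal; f_equal; lia.
Qed.

Lemma series_tail_small (u : nat -> R) eps : ex_series u -> 0 < eps ->
  exists J0, forall J, (J0 <= J)%nat -> Rabs (Series (fun n => u (J + n)%nat)) < eps.
Proof.
  intros Hu He.
  assert (H := Series_correct u Hu).
  apply (filterlim_locally (U := R_UniformSpace)) with (eps := mkposreal _ He) in H.
  destruct H as [N HN]. exists (S N). intros J HJ.
  rewrite (Series_incr_n u J) in HN by (auto; lia).
  specialize (HN (pred J) ltac:(lia)). rewrite sum_n_Reals in HN.
  change (Rabs (sum_f_R0 u (pred J) - (sum_f_R0 u (pred J)
     + Series (fun n => u (J + n)%nat))) < eps) in HN.
  rewrite <- Rabs_Ropp. replace (- Series (fun n => u (J + n)%nat)) with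
   (sum_f_R0 u (pred J) - (sum_f_R0 u (pred J) + Series (fun n => u (J + n)%nat))) by ring.
  auto.
Qed.

Lemma le_of_le_eps A B K : (forall eps, 0 < eps -> A <= B + eps * K) -> A <= B.
Proof.
  intros H. apply Rnot_lt_le. intros Hlt.
  pose proof (Rabs_pos K). pose proof (Rle_abs K).
  assert (He : 0 < (A - B) / (2 * (Rabs K + 1))) by (apply Rdiv_lt_0_compat; lra).
  specialize (H _ He).
  assert ((A - B) / (2 * (Rabs K + 1)) * (2 * (Rabs K + 1)) = A - B) by (field; lra).
  nra.
Qed.

(** Testing [Re p] on the circle of radius [r] against the trigonometric
    polynomial with coefficients [k].  A truncation of [p] has real part at least
    [- eps], so adding the constant [eps] to it reduces the claim to polynomials. *)
Lemma positive_real_part_kernel (p k : nat -> C) J kappa r :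
  cv_disk p -> 0 <= r < 1 -> (0 < J)%nat ->
  (forall z, Cmod z < 1 -> 0 <= Re (PS p z)) ->
  (forall w, Cmod w = 1 -> kappa <= Re (Csum (fun j => k j * Cconj w ^ j)%C J)) ->
  2 * kappa * Re (p 0%nat)
  <= Re (Csum (fun j => p j * RtoC (r ^ j) * k j)%C J + Cconj (p 0%nat) * k 0%nat)%C.
Proof.
  intros Hp Hr HJ Hpos HK.
  set (A := 2 * kappa * Re (p 0%nat)). set (B := Re _).
  apply le_of_le_eps with (K := 2 * (Re (k 0%nat) - kappa)). intros eps Heps.
  destruct (series_tail_small _ eps (Hp r Hr) Heps) as [J0 HJ0].
  set (J' := (J + J0)%nat).
  set (q := fun j => (p j * RtoC (r ^ j) + match j with O => RtoC eps | _ => RtoC 0 end)%C).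
  set (k' := fun j => if Compare_dec.lt_dec j J then k j else RtoC 0).
  assert (Ext : forall (F : nat -> C) n, (forall j, (J <= j)%nat -> F j = RtoC 0) ->
    Csum F (J + n) = Csum F J).
  { intros F n HF. induction n; [f_equal; lia|].
    rewrite Nat.add_succ_r. simpl. rewrite IHn, HF by lia. ring. }
  assert (Main := trig_poly_positivity J' q k' kappa ltac:(unfold J'; lia)).
  assert (Qsum : forall n (v : nat -> C), Csum (fun j => q j * v j)%C (S n)
    = (Csum (fun j => p j * RtoC (r ^ j) * v j)%C (S n) + RtoC eps * v 0%nat)%C).
  { intros n v. induction n; [unfold q; simpl; ring|].
    change (Csum (fun j => (q j * v j)%C) (S n) + q (S n) * v (S n) =
     (Csum (fun j => (p j * RtoC (r ^ j) * v j)%C) (S n) + p (S n) * RtoC (r ^ (S n)) * v (S n))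
      + RtoC eps * v 0%nat)%C.
    rewrite IHn. unfold q at 1. ring. }
  assert (EJ' : exists n, J' = S n) by (exists (pred J'); unfold J'; lia).
  assert (Hk'0 : k' 0%nat = k 0%nat) by (unfold k'; destruct (Compare_dec.lt_dec 0 J); [auto|lia]).
  unfold A, B.
  replace (2 * kappa * Re (p 0%nat)) with (2 * kappa * Re (q 0%nat) - 2 * kappa * eps)
    by (unfold q, Re; simpl; ring).
  apply Rplus_le_reg_r with (2 * kappa * eps).
  replace (2 * kappa * Re (q 0%nat) - 2 * kappa * eps + 2 * kappa * eps)
    with (2 * kappa * Re (q 0%nat)) by ring.
  eapply Rle_trans; [apply Main|].
  - intros w Hw.
    destruct EJ' as [n En]. rewrite En, Qsum, <- En.
    assert (Hz : Cmod (RtoC r * w) < 1) by (rewrite Cmod_mult, Cmod_R_nonneg, Hw; lra).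
    assert (Hs := cv_disk_summable p _ Hp Hz).
    destruct (CSeries_Csum _ J' Hs) as [E1 E2].
    specialize (Hpos _ Hz). unfold PS in Hpos. rewrite E1 in Hpos.
    assert (T := CSeries_mod _ E2).
    rewrite (Series_ext _ (fun n => Cmod (p (J' + n)%nat) * r ^ (J' + n))) in T.
    2:{ intros m. rewrite Cmod_mult, Cmod_pow, Cmod_mult, Hw, Cmod_R_nonneg by lra.
        f_equal; f_equal; ring. }
    specialize (HJ0 J' ltac:(unfold J'; lia)).
    pose proof (Rle_abs (Series (fun n => Cmod (p (J' + n)%nat) * r ^ (J' + n)))).
    rewrite (Csum_ext _ (fun j => p j * (RtoC r * w) ^ j)%C) by
      (intros; rewrite Cpow_mult_l, RtoC_pow; ring).
    set (S1 := Csum _ J') in *. set (S2 := CSeries _) in T, Hpos.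
    pose proof (Re_le_Cmod S2).
    change (0 <= Re S1 + Re S2) in Hpos.
    replace (Re (S1 + RtoC eps * w ^ 0)%C) with (Re S1 + eps) by (simpl; unfold Re; ring).
    lra.
  - intros w Hw. unfold J'. rewrite Ext.
    + rewrite (Csum_ext _ (fun j => k j * Cconj w ^ j)%C); auto.
      intros j Hj. unfold k'. destruct (Compare_dec.lt_dec j J); [auto|lia].
    + intros j Hj. unfold k'. destruct (Compare_dec.lt_dec j J); [lia|ring].
  - destruct EJ' as [n En]. rewrite En, Qsum, <- En. unfold J'. rewrite Ext.
    2:{ intros j Hj. unfold k'. destruct (Compare_dec.lt_dec j J); [lia|ring]. }
    rewrite (Csum_ext _ (fun j => p j * RtoC (r ^ j) * k j)%C).
    2:{ intros j Hj. unfold k'. destruct (Compare_dec.lt_dec j J); [auto|lia]. }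
    rewrite Hk'0. unfold q. simpl. unfold Re. apply Req_le. ring.
Qed.

Lemma nonneg_at_1 (phi : R -> R) :
  continuity_pt phi 1 -> (forall r, 0 < r < 1 -> 0 <= phi r) -> 0 <= phi 1.
Proof.
  intros Hc H. apply Rnot_lt_le. intros Hlt.
  destruct (Hc (- phi 1)) as [d [Hd Hcd]]; [lra|].
  set (r := Rmax (1 / 2) (1 - d / 2)).
  assert (Hr1 : 1 / 2 <= r) by apply Rmax_l.
  assert (Hr2 : 1 - d / 2 <= r) by apply Rmax_r.
  assert (Hr3 : r < 1) by (unfold r; apply Rmax_lub_lt; lra).
  specialize (Hcd r). specialize (H r ltac:(lra)).
  assert (Rabs (phi r - phi 1) < - phi 1).
  { apply Hcd. split.
    - split; [exact I|lra].
    - simpl. unfold R_dist. rewrite Rabs_left1; lra. }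
  pose proof (Rle_abs (phi r - phi 1)). lra.
Qed.

(** Caratheodory's coefficient bound, tested against the kernel
    [1 + Re (e conj(w)^n)]. *)
Lemma caratheodory p n e : cv_disk p ->
  (forall z, Cmod z < 1 -> 0 <= Re (PS p z)) -> (0 < n)%nat -> Cmod e = 1 ->
  - Re (e * p n)%C <= 2 * Re (p 0%nat).
Proof.
  intros Hp Hpos Hn He.
  set (k := fun j => if Nat.eq_dec j 0 then RtoC 1 else if Nat.eq_dec j n then e else RtoC 0).
  assert (Hk : forall v : nat -> C,
     Csum (fun j => k j * v j)%C (S n) = (v 0%nat + e * v n)%C).
  { intros v. simpl. rewrite (Csum_single _ n 0%nat Hn).
    - unfold k. destruct (Nat.eq_dec 0 0); [|lia]. destruct (Nat.eq_dec n 0); [lia|].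
      destruct (Nat.eq_dec n n); [ring|lia].
    - intros j H1 H2. unfold k. destruct (Nat.eq_dec j 0); [lia|].
      destruct (Nat.eq_dec j n); [lia|ring]. }
  assert (H : forall r, 0 < r < 1 -> 0 <= 2 * Re (p 0%nat) + Re (e * p n)%C * r ^ n).
  { intros r Hr.
    assert (M := positive_real_part_kernel p k (S n) 0 r Hp ltac:(lra) ltac:(lia) Hpos).
    rewrite (Csum_ext (fun j => p j * RtoC (r ^ j) * k j)%C
              (fun j => k j * (p j * RtoC (r ^ j)))%C), Hk in M by (intros; ring).
    replace (k 0%nat) with (RtoC 1) in M by reflexivity.
    replace (2 * Re (p 0%nat) + Re (e * p n)%C * r ^ n) with
      (Re (p 0%nat * RtoC (r ^ 0) + e * (p n * RtoC (r ^ n)) + Cconj (p 0%nat) * 1)%C)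
      by (simpl; unfold Re, Im; ring).
    replace 0 with (2 * 0 * Re (p 0%nat)) by ring. apply M.
    intros w Hw. rewrite Hk.
    pose proof (Re_le_Cmod (- (e * Cconj w ^ n))%C) as Hle.
    rewrite Cmod_opp, Cmod_mult, Cmod_pow, Cmod_conj, He, Hw, pow1 in Hle.
    simpl in *. lra. }
  assert (0 <= 2 * Re (p 0%nat) + Re (e * p n)%C * 1 ^ n).
  { apply (nonneg_at_1 (fun r => 2 * Re (p 0%nat) + Re (e * p n)%C * r ^ n)); auto.
    apply derivable_continuous_pt. apply ex_derive_Reals_0. auto_derive. auto. }
  rewrite pow1 in *. lra.
Qed.

Lemma Re_cayley s : Cmod s < 1 ->
  (1 - Cmod s) / (1 + Cmod s) <= Re ((1 + s) / (1 - s))%C.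
Proof.
  intros Hs. pose proof (Cmod_ge_0 s) as Hs0.
  assert (H2 := Cmod2_alt s).
  pose proof (re_le_Cmod s) as Hre. apply Rabs_le_between in Hre.
  destruct s as [x y]. set (m := Cmod (x, y)) in *.
  unfold Re, Im in H2, Hre; simpl in H2, Hre.
  replace (Re ((1 + (x, y)) / (1 - (x, y)))%C) with
    ((1 - x ^ 2 - y ^ 2) / ((1 - x) ^ 2 + y ^ 2)).
  2:{ simpl. unfold Re; simpl. field. nra. }
  assert (D : 0 < (1 - x) ^ 2 + y ^ 2) by nra.
  apply Rmult_le_reg_r with ((1 + m) * ((1 - x) ^ 2 + y ^ 2)); [nra|].
  replace ((1 - m) / (1 + m) * ((1 + m) * ((1 - x) ^ 2 + y ^ 2)))
    with ((1 - m) * ((1 - x) ^ 2 + y ^ 2)) by (field; lra).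
  replace ((1 - x ^ 2 - y ^ 2) / ((1 - x) ^ 2 + y ^ 2) * ((1 + m) * ((1 - x) ^ 2 + y ^ 2)))
    with ((1 + m) * (1 - x ^ 2 - y ^ 2)) by (field; lra).
  replace (1 - x ^ 2 - y ^ 2) with ((1 - m) * (1 + m)) by (simpl; lra).
  assert ((1 - x) ^ 2 + y ^ 2 <= (1 + m) * (1 + m)) by (simpl; nra). 
  nra.
Qed.

(** The truncated Poisson kernel differs from the full one by a geometric
    tail. *)
Lemma poisson_truncated s J : Cmod s < 1 -> (0 < J)%nat ->
  (1 - Cmod s) / (1 + Cmod s) - 2 * Cmod s ^ J / (1 - Cmod s)
  <= Re (Csum (fun j => (match j with O => 1 | _ => 2 end) * s ^ j)%C J).
Proof.
  intros Hs HJ. pose proof (Cmod_ge_0 s).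
  assert (H1s : (1 - s)%C <> RtoC 0).
  { intros E. assert (s = RtoC 1) by (replace s with (1 - (1 - s))%C by ring; rewrite E; ring).
    subst s. rewrite Cmod_1 in Hs. lra. }
  assert (E : forall n, Csum (fun j => (match j with O => 1 | _ => 2 end) * s ^ j)%C (S n)
      = ((1 + s) / (1 - s) - 2 * s ^ (S n) / (1 - s))%C).
  { induction n; [simpl; field; auto|].
    change (Csum (fun j => ((match j with O => 1 | _ => 2 end) * s ^ j)%C) (S n)
       + 2 * s ^ (S n) = ((1 + s) / (1 - s) - 2 * s ^ (S (S n)) / (1 - s)))%C.
    rewrite IHn. rewrite !Cpow_S. field. auto. }
  destruct J as [|n]; [lia|]. rewrite E.
  assert (Hc := Re_cayley s Hs).
  pose proof (Re_le_Cmod (2 * s ^ (S n) / (1 - s))%C) as Hm.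
  rewrite Cmod_div, Cmod_mult, Cmod_pow, Cmod_R_nonneg in Hm by (auto; lra).
  assert (Hlow : 1 - Cmod s <= Cmod (1 - s)).
  { pose proof (Cmod_triangle_rev 1 (- s)). rewrite Cmod_opp, Cmod_1 in H0. exact H0. }
  assert (2 * Cmod s ^ S n / Cmod (1 - s) <= 2 * Cmod s ^ S n / (1 - Cmod s)).
  { apply Rmult_le_compat_l; [pose proof (pow_le _ (S n) H); lra|].
    apply Rinv_le_contravar; lra. }
  change (Re ((1 + s) / (1 - s) - 2 * s ^ S n / (1 - s))%C) with
    (Re ((1 + s) / (1 - s))%C - Re (2 * s ^ S n / (1 - s))%C).
  lra.
Qed.

(** The Poisson kernel is evaluated at [t = z / r] with [|z| < r < 1]: its
    truncations are at least [(1 - |t|) / (1 + |t|)] up to a geometric error, and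
    letting [r] tend to [1] gives the bound at [z] itself. *)
Lemma harnack p z : cv_disk p ->
  (forall x, Cmod x < 1 -> 0 <= Re (PS p x)) -> Cmod z < 1 ->
  (1 - Cmod z) / (1 + Cmod z) * Re (p 0%nat) <= Re (PS p z).
Proof.
  intros Hp Hpos Hz. pose proof (Cmod_ge_0 z) as Hz0.
  set (c := Re (p 0%nat)). set (P := Re (PS p z)). set (m := Cmod z) in *.
  assert (Hr : forall r, m < r < 1 -> (r - m) / (r + m) * c <= P).
  { intros r Hr. set (t := (z / RtoC r)%C).
    assert (Hr0 : RtoC r <> RtoC 0) by (intros E; apply RtoC_inj in E; lra).
    assert (Ht : Cmod t = m / r) by (unfold t; rewrite Cmod_div, Cmod_R_nonneg by (auto; lra); auto).
    assert (Ht1 : 0 <= m / r < 1).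
    { split; [apply Rdiv_le_0_compat; lra|].
      apply Rmult_lt_reg_r with r; [lra|]. unfold Rdiv. rewrite Rmult_assoc, Rinv_l; lra. }
    replace ((r - m) / (r + m)) with ((1 - m / r) / (1 + m / r)) by (field; lra).
    set (rho := m / r) in *.
    assert (Hs := cv_disk_summable p z Hp Hz).
    assert (Fin : forall J, (0 < J)%nat ->
       ((1 - rho) / (1 + rho) - 2 * rho ^ J / (1 - rho)) * c
       <= P - Re (CSeries (fun n => p (J + n)%nat * z ^ (J + n))%C)).
    { intros J HJ. 
      set (k := fun j => ((match j with O => 1 | _ => 2 end) * t ^ j)%C).
      assert (M := positive_real_part_kernel p k J
         ((1 - rho) / (1 + rho) - 2 * rho ^ J / (1 - rho)) r Hp ltac:(lra) HJ Hpos).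
      destruct (CSeries_Csum _ J Hs) as [E1 _].
      unfold P, PS. rewrite E1.
      assert (Sum : forall n, (Csum (fun j => p j * RtoC (r ^ j) * k j) (S n) + p 0%nat
                 = 2 * Csum (fun j => p j * z ^ j) (S n))%C).
      { assert (Hterm : forall j, (RtoC (r ^ j) * t ^ j)%C = (z ^ j)%C).
        { intros j. rewrite RtoC_pow, <- Cpow_mult_l. f_equal. unfold t. field. auto. }
        induction n; [unfold k; simpl; ring|].
        change ((Csum (fun j => (p j * RtoC (r ^ j) * k j)%C) (S n)
           + p (S n) * RtoC (r ^ (S n)) * k (S n)) + p 0%nat =
           2 * (Csum (fun j => (p j * z ^ j)%C) (S n) + p (S n) * z ^ (S n)))%C.
        rewrite Cmult_plus_distr_l, <- IHn. rewrite <- (Hterm (S n)). unfold k at 2. ring. }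
      destruct J as [|n]; [lia|]. specialize (Sum n).
      set (S1 := Csum _ (S n)) in Sum. 
      assert (M' : 2 * ((1 - rho) / (1 + rho) - 2 * rho ^ (S n) / (1 - rho)) * c
        <= Re (S1 + Cconj (p 0%nat) * k 0%nat)%C).
      { apply M. intros w Hw.
        rewrite (Csum_ext _ (fun j => ((match j with O => 1 | _ => 2 end)
              * (t * Cconj w) ^ j)%C)) by (intros; rewrite Cpow_mult_l; unfold k; ring).
        assert (Et : Cmod (t * Cconj w) = rho) by (rewrite Cmod_mult, Cmod_conj, Hw, Ht; ring).
        rewrite <- Et. apply poisson_truncated; [lra|lia]. }
      replace (Re (S1 + Cconj (p 0%nat) * k 0%nat)%C) with (Re (S1 + p 0%nat)%C) in M'
        by (unfold k; simpl; unfold Re, Im; ring).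
      rewrite Sum in M'. clearbody S1.
      set (S2 := Csum (fun j => (p j * z ^ j)%C) (S n)) in *. set (S3 := CSeries _).
      replace (Re (2 * S2)%C) with (2 * Re S2) in M' by (simpl; unfold Re; ring).
      replace (Re (S2 + S3)%C - Re S3) with (Re S2) by (simpl; unfold Re; ring). fold c in M'. lra. }
    apply le_of_le_eps with (K := 1 + 2 / (1 - rho) * Rabs c). intros eps Heps.
    destruct (series_tail_small _ eps Hs Heps) as [J0 HJ0].
    destruct (pow_lt_1_zero rho ltac:(rewrite Rabs_pos_eq; lra) eps Heps) as [J1 HJ1].
    set (J := S (J0 + J1)).
    specialize (Fin J ltac:(unfold J; lia)). specialize (HJ0 J ltac:(unfold J; lia)).
    specialize (HJ1 J ltac:(unfold J; lia)).
    destruct (CSeries_Csum _ J Hs) as [_ E2]. assert (T := CSeries_mod _ E2).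
    set (S3 := CSeries _) in *.
    assert (- Re S3 <= Cmod S3) by (pose proof (Re_le_Cmod (- S3)%C); rewrite Cmod_opp in *; exact H).
    pose proof (Rle_abs (Series (fun n => Cmod (p (J + n)%nat * z ^ (J + n))%C))).
    assert (2 * rho ^ J / (1 - rho) * c <= eps * (2 / (1 - rho) * Rabs c)).
    { replace (2 * rho ^ J / (1 - rho) * c) with (2 / (1 - rho) * (rho ^ J * c)) by (field; lra).
      replace (eps * (2 / (1 - rho) * Rabs c)) with (2 / (1 - rho) * (eps * Rabs c)) by ring.
      apply Rmult_le_compat_l; [apply Rdiv_le_0_compat; lra|].
      eapply Rle_trans; [apply Rle_abs|]. rewrite Rabs_mult.
      apply Rmult_le_compat_r; [apply Rabs_pos|lra]. }
    lra. }
  apply Rminus_le. 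
  assert (0 <= (P - (1 - m) / (1 + m) * c)); [|lra].
  assert (Hcont : continuity_pt
     (fun s => P - (s * (1 - m)) / (2 * m + s * (1 - m)) * c) 1).
  { apply derivable_continuous_pt. apply ex_derive_Reals_0. auto_derive. lra. }
  apply nonneg_at_1 in Hcont.
  - replace (1 + m) with (2 * m + 1 * (1 - m)) by ring.
    rewrite Rmult_1_l in Hcont at 1. exact Hcont.
  - intros s Hs. specialize (Hr (m + s * (1 - m)) ltac:(nra)).
    replace (m + s * (1 - m) - m) with (s * (1 - m)) in Hr by ring.
    replace (m + s * (1 - m) + m) with (2 * m + s * (1 - m)) in Hr by ring. lra.
Qed.

(** * A minimum principle for Euler operators *)

(** At a minimum of [G] on [[0, r0]] other than [0] the derivative is
    nonpositive, so there [alpha G] dominates the whole operator; at [0] the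
    derivative term vanishes. *)
Lemma euler_minimum (G : R -> R) alpha beta kappa r0 :
  0 < alpha -> 0 <= beta -> 0 <= r0 ->
  (forall r, 0 <= r <= r0 -> ex_derive G r) ->
  (forall r, 0 <= r <= r0 -> kappa <= alpha * G r + beta * (r * Derive G r)) ->
  forall r, 0 <= r <= r0 -> kappa <= alpha * G r.
Proof.
  intros Ha Hb Hr0 HG HL r Hr.
  destruct (continuity_ab_min G 0 r0 Hr0) as [m [Hmin Hm]].
  { intros x Hx. apply derivable_continuous_pt, ex_derive_Reals_0, HG, Hx. }
  assert (Gm : kappa <= alpha * G m).
  { specialize (HL m Hm).
    destruct (Req_dec m 0) as [->|Hm0]; [lra|].
    assert (Hd : Derive G m <= 0); [|assert (0 <= beta * m * - Derive G m); [|lra];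
      apply Rmult_le_pos; [apply Rmult_le_pos|]; lra].
    apply Rnot_lt_le. intros Hl.
    assert (D : derivable_pt_lim G m (Derive G m))
      by (apply is_derive_Reals, Derive_correct, HG, Hm).
    destruct (D (Derive G m / 2) ltac:(lra)) as [d Hd].
    set (s := Rmin (d / 2) m).
    assert (Hd0 := cond_pos d).
    assert (Hs : 0 < s) by (unfold s; apply Rmin_pos; lra).
    assert (Hsd : s <= d / 2) by apply Rmin_l. assert (Hsm : s <= m) by apply Rmin_r.
    specialize (Hd (- s) ltac:(lra)). rewrite Rabs_Ropp, Rabs_pos_eq in Hd by lra.
    specialize (Hd ltac:(lra)). specialize (Hmin (m + - s) ltac:(lra)).
    assert ((G (m + - s) - G m) / - s <= 0).
    { replace ((G (m + - s) - G m) / - s) with (- ((G (m + - s) - G m) / s)) by (field; lra).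
      assert (0 <= (G (m + - s) - G m) / s) by (apply Rdiv_le_0_compat; lra). lra. }
    rewrite Rabs_left1 in Hd; lra. }
  specialize (Hmin r Hr). nra.
Qed.

Lemma Re_PS_real y r : Re (PS y (RtoC r)) = PSeries (fun n => Re (y n)) r.
Proof.
  apply Series_ext. intros n. rewrite <- RtoC_pow. simpl. unfold Re. ring.
Qed.

Lemma cv_disk_unshift c : cv_disk (fun n => c (S n)) -> cv_disk c.
Proof.
  intros Hc r Hr. apply ex_series_incr_1.
  apply ex_series_bound with (2 := ex_series_scal r _ (Hc r Hr)).
  intros n. change (scal r (Cmod (c (S n)) * r ^ n)) with (r * (Cmod (c (S n)) * r ^ n)).
  rewrite Rabs_pos_eq.
  - apply Req_le; simpl; ring.
  - apply Rmult_le_pos; [apply Cmod_ge_0 | apply pow_le; lra].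
Qed.

Lemma cv_disk_ext c d : (forall n, c n = d n) -> cv_disk c -> cv_disk d.
Proof.
  intros H Hc r Hr. eapply ex_series_ext; [|apply (Hc r Hr)].
  intros; simpl; rewrite H; auto.
Qed.

Lemma cv_disk_mul_INR c : cv_disk c -> cv_disk (fun n => RtoC (INR n) * c n)%C.
Proof. intros Hc. apply cv_disk_unshift. apply (cv_disk_dcoef c Hc). Qed.

Lemma PS_ext c d z : (forall n, c n = d n) -> PS c z = PS d z.
Proof. intros H; apply CSeries_ext; intros; rewrite H; auto. Qed.

Lemma PS_zero z : PS (fun _ => RtoC 0) z = RtoC 0.
Proof.
  assert (E : forall u : nat -> R, (forall n, u n = 0) -> Series u = 0).
  { intros u Hu. rewrite (Series_ext u (fun n => 0 * u n)) by (intros; rewrite Hu; ring).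
    rewrite Series_scal_l. ring. }
  apply C_eq; apply E; intros n; rewrite Cmult_0_l; reflexivity.
Qed.

Lemma PS_euler c z : cv_disk c -> Cmod z < 1 ->
  (z * PS (dcoef c) z)%C = PS (fun n => RtoC (INR n) * c n)%C z.
Proof.
  intros Hc Hz. rewrite (PS_shift (fun n => RtoC (INR n) * c n)%C)
    by auto using cv_disk_mul_INR.
  unfold dcoef. simpl (INR 0). ring.
Qed.

Lemma cv_disk_affine alpha beta c : cv_disk c ->
  cv_disk (fun n => RtoC (alpha + beta * INR n) * c n)%C.
Proof.
  intros Hc.
  apply cv_disk_ext with (fun n => RtoC alpha * c n + RtoC beta * (RtoC (INR n) * c n))%C.
  - intros n. rewrite RtoC_plus, RtoC_mult. ring.
  - apply cv_disk_plus; apply cv_disk_scal; auto using cv_disk_mul_INR.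
Qed.

Lemma euler_minimum_PS y alpha beta kappa r0 :
  cv_disk y -> 0 < alpha -> 0 <= beta -> 0 <= r0 < 1 ->
  (forall r, 0 <= r <= r0 ->
     kappa <= Re (PS (fun n => RtoC (alpha + beta * INR n) * y n)%C (RtoC r))) ->
  forall r, 0 <= r <= r0 -> kappa <= alpha * Re (PS y (RtoC r)).
Proof.
  intros Hy Ha Hb Hr0 H.
  set (A := fun n => Re (y n)).
  assert (HA : forall r, 0 <= r <= r0 -> Rbar_lt (Rabs r) (CV_radius A)).
  { intros r Hr. apply Rbar_lt_le_trans with 1.
    - simpl. rewrite Rabs_pos_eq; lra.
    - apply (cv_disk_radius y); auto. intros; apply re_le_Cmod. }
  assert (E : forall r, 0 <= r <= r0 ->
    Re (PS (fun n => RtoC (alpha + beta * INR n) * y n)%C (RtoC r))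
    = alpha * PSeries A r + beta * (r * Derive (PSeries A) r)).
  { intros r Hr.
    assert (Hz : Cmod (RtoC r) < 1) by (rewrite Cmod_R_nonneg; lra).
    rewrite (PS_ext _ (fun n => RtoC alpha * y n + RtoC beta * (RtoC (INR n) * y n))%C)
      by (intros; rewrite RtoC_plus, RtoC_mult; ring).
    rewrite PS_plus_coef, !PS_scal_coef, <- PS_euler
      by auto using cv_disk_scal, cv_disk_mul_INR.
    rewrite Derive_PSeries by auto.
    change (Re (RtoC alpha * PS y (RtoC r))%C
      + Re (RtoC beta * (RtoC r * PS (dcoef y) (RtoC r)))%C
      = alpha * PSeries A r + beta * (r * PSeries (PS_derive A) r)).
    rewrite !re_scal_l, !Re_PS_real. unfold A, PS_derive.
    do 3 f_equal. apply PSeries_ext. intros n. unfold dcoef. rewrite re_scal_l. auto. }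
  intros r Hr. rewrite Re_PS_real. fold A.
  apply (euler_minimum (PSeries A) alpha beta kappa r0); auto; try lra.
  - intros x Hx. apply ex_derive_PSeries, HA, Hx.
  - intros x Hx. rewrite <- E by auto. apply H, Hx.
Qed.

(** * The class in terms of Taylor coefficients *)

(** The operator maps [z^(n+1)] to [op_weight n z^n].  The factors [n + 1],
    [n + 1] and [gam + (del - gam) / 2 n] are those of the three first order Euler
    operators to which the minimum principle is applied in turn. *)
Definition op_weight (gam del : R) (n : nat) : R :=
  (INR n + 1) ^ 2 * (gam + (del - gam) / 2 * INR n).

Definition op_coef (gam del : R) (c : nat -> C) (n : nat) : C :=
  (RtoC (op_weight gam del n) * c (S n))%C.

Definition coef_class (gam del lam : R) (c d : nat -> C) : Prop :=
  cv_disk c /\ cv_disk d /\ c 1%nat = RtoC 1 /\ d 1%nat = RtoC 0 /\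
  forall z, Cmod z < 1 ->
    Cmod (PS (op_coef gam del d) z) < Re (PS (op_coef gam del c) z) - lam.

Lemma denom_op_weight gam del n : denom gam del (S n) = 2 * op_weight gam del n.
Proof. unfold denom, op_weight. rewrite S_INR. field. Qed.

Lemma op_weight_pos gam del n : 0 < gam <= del -> 0 < op_weight gam del n.
Proof.
  intros H. unfold op_weight. pose proof (pos_INR n).
  apply Rmult_lt_0_compat; [nra|].
  assert (0 <= (del - gam) / 2 * INR n) by (apply Rmult_le_pos; lra). lra.
Qed.

Lemma cv_disk_op_coef gam del c : cv_disk c -> cv_disk (op_coef gam del c).
Proof.
  intros Hc.
  apply cv_disk_ext with (fun n => RtoC (1 + 1 * INR n) * (RtoC (1 + 1 * INR n) *
     (RtoC (gam + (del - gam) / 2 * INR n) * c (S n))))%C.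
  - intros n. unfold op_coef, op_weight. rewrite !Cmult_assoc, <- !RtoC_mult.
    f_equal. f_equal. ring.
  - apply (cv_disk_affine 1 1), (cv_disk_affine 1 1),
      (cv_disk_affine gam ((del - gam) / 2) (fun n => c (S n))), cv_disk_shift, Hc.
Qed.

Lemma diff_op_PS gam del f c : cv_disk c ->
  (forall z, Cmod z < 1 -> f z = PS c z) ->
  forall z, Cmod z < 1 -> diff_op gam del f z = PS (op_coef gam del c) z.
Proof.
  intros Hc Hf z Hz.
  assert (H1 := C_derive_PS f c Hc Hf).
  assert (Hc1 := cv_disk_dcoef _ Hc).
  assert (H2 := C_derive_PS _ _ Hc1 H1).
  assert (Hc2 := cv_disk_dcoef _ Hc1).
  assert (H3 := C_derive_PS _ _ Hc2 H2).
  unfold diff_op. rewrite H1, H2, H3 by auto.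
  set (e := dcoef c) in *.
  assert (Hm := cv_disk_mul_INR _ Hc1).
  assert (E2 : (z ^ 2 * PS (dcoef (dcoef e)) z)%C
    = PS (fun n => RtoC (INR n - 1) * (RtoC (INR n) * e n))%C z).
  { replace (z ^ 2)%C with (z * z)%C by (simpl; ring).
    rewrite <- Cmult_assoc, PS_euler by auto.
    rewrite (PS_shift (fun n => RtoC (INR n - 1) * (RtoC (INR n) * e n))%C); auto.
    - simpl (INR 0). rewrite Cmult_0_l, Cmult_0_r, Cplus_0_l. f_equal.
      apply PS_ext. intros n. unfold dcoef. rewrite S_INR.
      replace (INR n + 1 - 1) with (INR n) by ring. auto.
    - apply cv_disk_ext with (2 := cv_disk_affine (-1) 1 _ Hm).
      intros n. simpl. f_equal. f_equal. ring. }
  rewrite <- !Cmult_assoc, E2, PS_euler by auto.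
  assert (Hm2 : cv_disk (fun n => RtoC (INR n - 1) * (RtoC (INR n) * e n))%C).
  { apply cv_disk_ext with (2 := cv_disk_affine (-1) 1 _ Hm).
      intros n. simpl. f_equal. f_equal. ring. }
  rewrite <- !PS_scal_coef by auto.
  rewrite <- !PS_plus_coef by auto using cv_disk_plus, cv_disk_scal.
  apply PS_ext. intros n. unfold e, dcoef, op_coef, op_weight.
  rewrite S_INR, !Cmult_assoc, <- !RtoC_mult, <- !Cmult_plus_distr_r, <- !RtoC_plus.
  f_equal. f_equal. field.
Qed.

Lemma is_series_C_bounded (a : nat -> C) l :
  @is_series C_AbsRing C_NormedModule a l -> exists M, forall n, Cmod (a n) <= M.
Proof.
  intros H. apply is_series_C_iff in H as [H1 H2].
  assert (B : forall u : nat -> R, ex_series u -> exists M, forall n, Rabs (u n) <= M).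
  { intros u Hu. apply ex_series_lim_0 in Hu.
    destruct (filterlim_bounded _ (ex_intro _ 0 Hu)) as [M HM].
    exists M. intros n. apply HM. }
  destruct (B _ (ex_intro _ _ H1)) as [M1 HM1].
  destruct (B _ (ex_intro _ _ H2)) as [M2 HM2].
  exists (M1 + M2). intros n. specialize (HM1 n); specialize (HM2 n).
  destruct (a n) as [x y]. simpl in HM1, HM2.
  replace (x, y) with (RtoC x + Ci * RtoC y)%C by (apply C_eq; simpl; ring).
  eapply Rle_trans; [apply Cmod_triangle|].
  rewrite Cmod_mult, Cmod_Ci, !Cmod_R. lra.
Qed.

(** The coefficient sequences of the class start at index [2]; the normalization
    supplies [0] and [x] before it. *)
Definition head2 (x : C) (a : nat -> C) (n : nat) : C :=
  match n with O => RtoC 0 | S O => x | _ => a n end.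

Lemma expansion_PS x a F : expansion_from2 a F ->
  cv_disk (head2 x a) /\
  forall z, Cmod z < 1 -> PS (head2 x a) z = (x * z + F z)%C.
Proof.
  intros H.
  assert (Hcv : cv_disk (head2 x a)).
  { apply cv_disk_unshift, cv_disk_unshift, cv_disk_of_bounded. intros r Hr.
    assert (Hz : in_disk (RtoC r)) by (unfold in_disk; rewrite Cmod_R_nonneg; lra).
    destruct (is_series_C_bounded _ _ (H _ Hz)) as [M HM].
    exists (M / r ^ 2). intros n. specialize (HM n).
    rewrite Cmod_mult, Cmod_pow, Cmod_R_nonneg in HM by lra.
    replace (n + 2)%nat with (S (S n)) in HM by lia. simpl head2.
    apply Rmult_le_reg_r with (r ^ 2); [apply pow_lt; lra|].
    replace (M / r ^ 2 * r ^ 2) with M by (field; lra).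
    eapply Rle_trans; [|exact HM]. apply Req_le; simpl; ring. }
  split; auto. intros z Hz.
  rewrite PS_shift, PS_shift by auto using cv_disk_shift.
  rewrite <- (is_series_C_unique _ _ (H z Hz)).
  simpl (head2 x a 0). simpl (head2 x a 1).
  assert (E : (z * (z * PS (fun n => head2 x a (S (S n))) z))%C
     = CSeries (fun k => (a (k + 2)%nat * z ^ (k + 2))%C)).
  { unfold PS. assert (Hs : abs_summable (fun n => (head2 x a (S (S n)) * z ^ n)%C))
      by (apply (cv_disk_summable (fun n => head2 x a (S (S n)))); auto;
          apply (cv_disk_shift (fun n => head2 x a (S n))), cv_disk_shift, Hcv).
    rewrite <- !CSeries_scal by auto using abs_summable_scal.
    apply CSeries_ext. intros n. replace (n + 2)%nat with (S (S n)) by lia. simpl. ring. }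
  rewrite <- E. ring.
Qed.

Lemma phase z : exists u, Cmod u = 1 /\ (u * z)%C = RtoC (Cmod z).
Proof.
  destruct (Req_dec (Cmod z) 0) as [E|E].
  - exists (RtoC 1). split; [apply Cmod_1|].
    rewrite E. apply Cmod_eq_0 in E. rewrite E. ring.
  - assert (E' : RtoC (Cmod z) <> RtoC 0) by (intros F; apply RtoC_inj in F; auto).
    exists (Cconj z / RtoC (Cmod z))%C. split.
    + rewrite Cmod_div, Cmod_conj, Cmod_R_nonneg by auto using Cmod_ge_0. field; auto.
    + unfold Cdiv. replace (Cconj z * / RtoC (Cmod z) * z)%C with
        (z * Cconj z * / RtoC (Cmod z))%C by ring.
      rewrite <- Cmod2_conj, RtoC_pow. field. auto.
Qed.

(** Rotating the co-analytic part turns the pair into one analytic function of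
    positive real part: this is the sequence of its coefficients. *)
Definition rotated (gam del lam : R) (c d : nat -> C) (e : C) (n : nat) : C :=
  (RtoC (op_weight gam del n) * (c (S n) + e * d (S n))
   - match n with O => RtoC lam | _ => RtoC 0 end)%C.

Lemma rotated_positive gam del lam c d e :
  coef_class gam del lam c d -> Cmod e = 1 ->
  cv_disk (rotated gam del lam c d e) /\
  rotated gam del lam c d e 0%nat = RtoC (gam - lam) /\
  forall z, Cmod z < 1 -> 0 <= Re (PS (rotated gam del lam c d e) z).
Proof.
  intros (Hc & Hd & Hc1 & Hd1 & Hpos) He.
  set (k := fun n => match n with O => RtoC 1 | _ => RtoC 0 end : C).
  assert (Hk : cv_disk k).
  { apply cv_disk_unshift. intros r Hr.
    apply ex_series_bound with (fun n => r ^ n).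
    - intros n. unfold k. rewrite Cmod_0, Rmult_0_l, Rabs_R0. apply pow_le; lra.
    - apply ex_series_geom. rewrite Rabs_pos_eq; lra. }
  assert (Hk1 : forall z, Cmod z < 1 -> PS k z = RtoC 1).
  { intros z Hz. rewrite PS_shift by auto.
    rewrite (PS_ext (fun n => k (S n)) (fun _ => RtoC 0)) by auto.
    rewrite PS_zero. unfold k. ring. }
  assert (Hop := cv_disk_op_coef gam del c Hc). assert (Hod := cv_disk_op_coef gam del d Hd).
  assert (E : forall n, (op_coef gam del c n + e * op_coef gam del d n + (- RtoC lam) * k n)%C
      = rotated gam del lam c d e n).
  { intros n. unfold rotated, op_coef, k. destruct n; ring. }
  split; [|split].
  - eapply cv_disk_ext; [exact E|].
    auto using cv_disk_plus, cv_disk_scal.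
  - unfold rotated, op_weight. rewrite Hc1, Hd1. simpl.
    apply C_eq; simpl; ring.
  - intros z Hz. rewrite <- (PS_ext _ _ z E).
    rewrite !PS_plus_coef, !PS_scal_coef, Hk1 by auto using cv_disk_plus, cv_disk_scal.
    specialize (Hpos z Hz). set (A := PS _ z) in Hpos. set (B := PS _ z) in Hpos.
    assert (HB := Re_le_Cmod (- (e * B))%C). rewrite Cmod_opp, Cmod_mult, He in HB.
    fold A B.
    change (0 <= Re B + Re (e * A)%C + Re (- RtoC lam * 1)%C).
    replace (Re (- RtoC lam * 1)%C) with (- lam) by (simpl; unfold Re; simpl; ring).
    assert (HA := Re_le_Cmod (- (e * A))%C). rewrite Cmod_opp, Cmod_mult, He in HA.
    change (- Re (e * A)%C <= 1 * Cmod A) in HA. lra.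
Qed.

(** Choosing the rotation [e] so that [e d_n] has the phase of [c_n] turns the
    bound on one coefficient into a bound on the sum of two moduli. *)
Lemma coefficient_bound gam del lam c d n :
  0 < gam <= del -> coef_class gam del lam c d ->
  Cmod (c (S (S n))) + Cmod (d (S (S n))) <= 4 * (gam - lam) / denom gam del (S (S n)).
Proof.
  intros Hg H. rewrite denom_op_weight.
  assert (Hw := op_weight_pos gam del (S n) Hg).
  destruct (phase (c (S (S n)))) as [u1 [Hu1 E1]].
  destruct (phase (d (S (S n)))) as [u2 [Hu2 E2]].
  assert (He : Cmod (u2 * Cconj u1) = 1) by (rewrite Cmod_mult, Cmod_conj, Hu1, Hu2; ring).
  destruct (rotated_positive _ _ _ _ _ _ H He) as (Hp & Hp0 & Hpos).
  assert (K := caratheodory _ (S n) (- u1)%C Hp Hpos ltac:(lia)).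
  rewrite Cmod_opp in K. specialize (K Hu1). rewrite Hp0 in K.
  replace (- u1 * rotated gam del lam c d (u2 * Cconj u1) (S n))%C
    with (RtoC (- (op_weight gam del (S n) * (Cmod (c (S (S n))) + Cmod (d (S (S n))))))) in K.
  - simpl in K. apply Rmult_le_reg_r with (2 * op_weight gam del (S n)); [lra|].
    replace (4 * (gam - lam) / (2 * op_weight gam del (S n)) * (2 * op_weight gam del (S n)))
      with (4 * (gam - lam)) by (field; lra). lra.
  - unfold rotated. rewrite RtoC_opp, RtoC_mult, RtoC_plus, <- E1, <- E2.
    replace (- u1 * (op_weight gam del (S n) * (c (S (S n)) + u2 * Cconj u1 * d (S (S n))) - 0))%C
     with (- (op_weight gam del (S n) * (u1 * c (S (S n)) + (u1 * Cconj u1) * u2 * d (S (S n)))))%C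
       by ring.
    rewrite (unit_conj u1 Hu1). ring.
Qed.

Definition halfplane_coef (n : nat) : C := match n with O => RtoC 1 | _ => RtoC 2 end.

Lemma bounded_cv_disk (c : nat -> C) M : (forall n, Cmod (c n) <= M) -> cv_disk c.
Proof.
  intros H. apply cv_disk_of_bounded. intros r Hr. exists M. intros n.
  pose proof (pow_le r n ltac:(lra)). pose proof (Cmod_ge_0 (c n)).
  assert (r ^ n <= 1) by (rewrite <- (pow1 n); apply pow_incr; lra).
  specialize (H n). nra.
Qed.

Lemma cv_disk_halfplane : cv_disk halfplane_coef.
Proof.
  apply bounded_cv_disk with 2. intros [|n]; simpl; rewrite Cmod_R_nonneg; lra.
Qed.

Lemma PS_halfplane z : Cmod z < 1 -> PS halfplane_coef z = ((1 + z) / (1 - z))%C.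
Proof.
  intros Hz. pose proof cv_disk_halfplane as Hk.
  set (G := PS (fun _ => RtoC 1) z).
  assert (H1 : cv_disk (fun _ => RtoC 1)).
  { apply bounded_cv_disk with 1. intros n. rewrite Cmod_1; lra. }
  assert (HG : (G * (1 - z))%C = RtoC 1).
  { assert (E : G = (1 + z * G)%C) by (apply (PS_shift (fun _ => RtoC 1)); auto).
    replace (G * (1 - z))%C with (G - z * G)%C by ring. rewrite E at 1. ring. }
  assert (Hz1 : (1 - z)%C <> RtoC 0).
  { intros F. rewrite F, Cmult_0_r in HG. apply RtoC_inj in HG. lra. }
  rewrite PS_shift by auto. simpl (halfplane_coef 0).
  rewrite (PS_ext (fun n => halfplane_coef (S n)) (fun n => RtoC 2 * RtoC 1)%C)
    by (intros; simpl; ring).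
  rewrite PS_scal_coef by auto. fold G.
  replace G with (/ (1 - z))%C.
  - field. auto.
  - replace (/ (1 - z))%C with (/ (1 - z) * (G * (1 - z)))%C by (rewrite HG; ring).
    field. auto.
Qed.

(** Taylor coefficients of [extremal_fun z / z]: the operator sends
    [extremal_fun] to [lam + (gam - lam) (1 + z) / (1 - z)]. *)
Definition extremal (gam del lam : R) (n : nat) : R :=
  match n with O => 1 | _ => 4 * (gam - lam) / denom gam del (S n) end.

Definition extremal_PS (gam del lam : R) (z : C) : C :=
  PS (fun n => RtoC (extremal gam del lam n)) z.

Lemma extremal_op gam del lam n : 0 < gam <= del ->
  op_weight gam del n * extremal gam del lam n =
  (gam - lam) * Re (halfplane_coef n) + match n with O => lam | _ => 0 end.
Proof.
  intros Hg. unfold extremal. destruct n.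
  - unfold op_weight; simpl. ring.
  - rewrite denom_op_weight. pose proof (op_weight_pos gam del (S n) Hg).
    simpl. field. lra.
Qed.

Lemma denom_ge gam del n : 0 < gam <= del -> 2 * gam * INR (S n) ^ 2 <= denom gam del (S n).
Proof.
  intros Hg. unfold denom. rewrite S_INR. pose proof (pos_INR n).
  replace (INR n + 1 - 1) with (INR n) by ring.
  assert (0 <= (del - gam) * INR n) by (apply Rmult_le_pos; lra).
  assert (0 <= (INR n + 1) ^ 2) by nra. nra.
Qed.

Lemma denom_pos gam del n : 0 < gam <= del -> 0 < denom gam del (S n).
Proof. intros Hg. rewrite denom_op_weight. pose proof (op_weight_pos gam del n Hg). lra. Qed.

Lemma extremal_pos gam del lam n : lam < gam -> 0 < gam <= del -> 0 < extremal gam del lam n.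
Proof.
  intros Hl Hg. unfold extremal. destruct n; [lra|].
  apply Rdiv_lt_0_compat; [lra|apply denom_pos; auto].
Qed.

Lemma extremal_cv gam del lam : lam < gam -> 0 < gam <= del ->
  cv_disk (fun n => RtoC (extremal gam del lam n)).
Proof.
  intros Hl Hg.
  apply bounded_cv_disk with (1 + 4 * (gam - lam) / (2 * gam)). intros n.
  rewrite Cmod_R_nonneg by (apply Rlt_le, extremal_pos; auto).
  assert (0 < 4 * (gam - lam) / (2 * gam)) by (apply Rdiv_lt_0_compat; lra).
  unfold extremal. destruct n; [lra|].
  assert (4 * (gam - lam) / denom gam del (S (S n)) <= 4 * (gam - lam) / (2 * gam)); [|lra].
  apply Rmult_le_compat_l; [lra|]. apply Rinv_le_contravar; [lra|].
  eapply Rle_trans; [|apply denom_ge; auto].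
  assert (1 <= INR (S (S n))) by (rewrite S_INR; pose proof (pos_INR (S n)); lra).
  assert (1 <= INR (S (S n)) ^ 2) by nra. nra.
Qed.

Lemma PS_rotate y u r : PS (fun n => y n * u ^ n)%C (RtoC r) = PS y (RtoC r * u).
Proof. apply CSeries_ext; intros n. rewrite Cpow_mult_l. ring. Qed.

Lemma cv_disk_rotate y u : Cmod u = 1 -> cv_disk y -> cv_disk (fun n => y n * u ^ n)%C.
Proof.
  intros Hu Hy r Hr. eapply ex_series_ext; [|apply (Hy r Hr)].
  intros n; simpl. rewrite Cmod_mult, Cmod_pow, Hu, pow1. ring.
Qed.

Lemma polar z : exists u, Cmod u = 1 /\ (RtoC (Cmod z) * u)%C = z.
Proof.
  destruct (phase z) as [u [Hu E]]. exists (Cconj u). split.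
  - rewrite Cmod_conj; auto.
  - rewrite <- E. replace (u * z * Cconj u)%C with (u * Cconj u * z)%C by ring.
    rewrite unit_conj by auto. ring.
Qed.

Lemma PS_minus_coef c d z : cv_disk c -> cv_disk d -> Cmod z < 1 ->
  PS (fun n => (c n - d n)%C) z = (PS c z - PS d z)%C.
Proof.
  intros Hc Hd Hz.
  rewrite (PS_ext _ (fun n => c n + (- RtoC 1) * d n)%C) by (intros; ring).
  rewrite PS_plus_coef, PS_scal_coef by auto using cv_disk_scal. ring.
Qed.

Lemma cv_disk_minus c d : cv_disk c -> cv_disk d -> cv_disk (fun n => (c n - d n)%C).
Proof.
  intros Hc Hd. apply cv_disk_ext with (fun n => c n + (- RtoC 1) * d n)%C; [intros; ring|].
  auto using cv_disk_plus, cv_disk_scal.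
Qed.

(** Along each ray the difference with the extremal function at the opposite
    point [- r] is mapped by three Euler operators to a function that is
    nonnegative by Harnack's inequality. *)
Lemma rotated_lower_bound gam del lam c d e z :
  0 < gam <= del -> lam < gam -> coef_class gam del lam c d -> Cmod e = 1 -> Cmod z < 1 ->
  Re (extremal_PS gam del lam (RtoC (- Cmod z)))
  <= Re (PS (fun n => c (S n) + e * d (S n))%C z).
Proof.
  intros Hg Hlg H He Hz.
  destruct (rotated_positive _ _ _ _ _ _ H He) as (Hp & Hp0 & Hpos).
  destruct H as (Hc & Hd & Hc1 & Hd1 & _).
  destruct (polar z) as [u [Hu Ez]].
  set (X := fun n => (c (S n) + e * d (S n))%C).
  assert (HX : cv_disk X).
  { apply cv_disk_plus; [apply cv_disk_shift; auto|].
    apply cv_disk_scal, (cv_disk_shift d); auto. }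
  set (m1 := (- RtoC 1)%C). assert (Hm1 : Cmod m1 = 1) by apply Cmod_m1.
  set (xs := fun n => RtoC (extremal gam del lam n)).
  assert (Hxs : cv_disk xs) by (apply extremal_cv; auto).
  (* [y] is the difference along the ray of direction [u], and [y1], [y2], [y3]
     are its images under the successive Euler factors. *)
  set (y := fun n => (X n * u ^ n - xs n * m1 ^ n)%C).
  assert (Hy : cv_disk y) by (apply cv_disk_minus; apply cv_disk_rotate; auto).
  set (y1 := fun n => (RtoC (gam + (del - gam) / 2 * INR n) * y n)%C).
  assert (Hy1 : cv_disk y1) by (apply cv_disk_affine; auto).
  set (y2 := fun n => (RtoC (1 + 1 * INR n) * y1 n)%C).
  assert (Hy2 : cv_disk y2) by (apply cv_disk_affine; auto).
  set (y3 := fun n => (RtoC (1 + 1 * INR n) * y2 n)%C).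
  assert (E3 : forall n, y3 n = (rotated gam del lam c d e n * u ^ n
        - RtoC (gam - lam) * (halfplane_coef n * m1 ^ n))%C).
  { intros n.
    transitivity (RtoC (op_weight gam del n) * (X n * u ^ n - xs n * m1 ^ n))%C.
    - unfold y3, y2, y1, y, op_weight. rewrite !Cmult_assoc, <- !RtoC_mult.
      f_equal. f_equal. ring.
    - unfold rotated. fold (X n).
      replace (RtoC (op_weight gam del n) * (X n * u ^ n - xs n * m1 ^ n))%C with
        (RtoC (op_weight gam del n) * X n * u ^ n - 
          RtoC (op_weight gam del n * extremal gam del lam n) * m1 ^ n)%C
        by (unfold xs; rewrite RtoC_mult; ring).
      rewrite extremal_op by auto. rewrite RtoC_plus, RtoC_mult.
      destruct n; simpl; ring. }
  assert (Base : forall r, 0 <= r <= Cmod z -> 0 <= Re (PS y3 (RtoC r))).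
  { intros r Hr. rewrite (PS_ext _ _ _ E3).
    assert (Hr1 : Cmod (RtoC r) < 1) by (rewrite Cmod_R_nonneg; lra).
    assert (Hr2 : Cmod (RtoC r * u) = r) by (rewrite Cmod_mult, Cmod_R_nonneg, Hu; lra).
    rewrite PS_minus_coef, PS_scal_coef, !PS_rotate, PS_halfplane;
      auto using cv_disk_rotate, cv_disk_scal, cv_disk_halfplane.
    2:{ rewrite Cmod_mult, Hm1, Rmult_1_r. auto. }
    assert (Hh := harnack _ (RtoC r * u)%C Hp Hpos ltac:(lra)).
    rewrite Hr2, Hp0 in Hh. simpl (Re (RtoC (gam - lam))) in Hh.
    set (P := PS _ _) in *.
    replace (RtoC (gam - lam) * ((1 + RtoC r * m1) / (1 - RtoC r * m1)))%C with
      (RtoC ((1 - r) / (1 + r) * (gam - lam))).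
    - change (0 <= Re P - (1 - r) / (1 + r) * (gam - lam)). lra.
    - rewrite RtoC_mult, RtoC_div, RtoC_minus, RtoC_plus by lra. unfold m1. field.
      intros F; apply (f_equal Re) in F; simpl in F; lra. }
  assert (Hz0 := Cmod_ge_0 z).
  assert (B2 := euler_minimum_PS y2 1 1 0 (Cmod z) Hy2 ltac:(lra) ltac:(lra) ltac:(lra) Base).
  assert (B1 := euler_minimum_PS y1 1 1 0 (Cmod z) Hy1 ltac:(lra) ltac:(lra) ltac:(lra)).
  assert (B1' : forall r, 0 <= r <= Cmod z -> 0 <= 1 * Re (PS y1 (RtoC r))).
  { apply B1. intros r Hr. specialize (B2 r Hr). fold y2. lra. }
  assert (B0 := euler_minimum_PS y gam ((del - gam) / 2) 0 (Cmod z) Hy ltac:(lra) ltac:(lra) ltac:(lra)).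
  assert (B : 0 <= gam * Re (PS y (RtoC (Cmod z)))).
  { apply B0; [|lra]. intros r Hr. specialize (B1' r Hr). fold y1. lra. }
  assert (Hr1 : Cmod (RtoC (Cmod z)) < 1) by (rewrite Cmod_R_nonneg; lra).
  unfold y in B. rewrite PS_minus_coef, !PS_rotate, Ez in B by auto using cv_disk_rotate.
  replace (RtoC (Cmod z) * m1)%C with (RtoC (- Cmod z)) in B
    by (unfold m1; rewrite RtoC_opp; ring).
  change (0 <= gam * (Re (PS X z) - Re (extremal_PS gam del lam (RtoC (- Cmod z))))) in B.
  fold X. apply Rmult_le_reg_l with gam; lra.
Qed.

(** Only the factors [n + 1] and [gam + (del - gam) / 2 n] separate the
    derivative from [lam + p], which Harnack's inequality bounds away from [0]. *)
Lemma rotated_derivative_pos gam del lam c d e z :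
  0 < gam <= del -> 0 <= lam < gam -> coef_class gam del lam c d -> Cmod e = 1 -> Cmod z < 1 ->
  0 < Re (PS (dcoef c) z + e * PS (dcoef d) z)%C.
Proof.
  intros Hg Hlg H He Hz.
  destruct (rotated_positive _ _ _ _ _ _ H He) as (Hp & Hp0 & Hpos).
  destruct H as (Hc & Hd & Hc1 & Hd1 & _).
  destruct (polar z) as [u [Hu Ez]]. assert (Hz0 := Cmod_ge_0 z).
  assert (HDc := cv_disk_dcoef _ Hc). assert (HDd := cv_disk_dcoef _ Hd).
  set (X := fun n => (dcoef c n + e * dcoef d n)%C).
  assert (HX : cv_disk X) by (apply cv_disk_plus; auto using cv_disk_scal).
  replace (PS (dcoef c) z + e * PS (dcoef d) z)%C with (PS X z)
    by (unfold X; rewrite PS_plus_coef, PS_scal_coef; auto using cv_disk_scal).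
  set (y := fun n => (X n * u ^ n)%C).
  assert (Hy : cv_disk y) by (apply cv_disk_rotate; auto).
  set (y1 := fun n => (RtoC (gam + (del - gam) / 2 * INR n) * y n)%C).
  assert (Hy1 : cv_disk y1) by (apply cv_disk_affine; auto).
  set (y2 := fun n => (RtoC (1 + 1 * INR n) * y1 n)%C).
  assert (Hy2 : cv_disk y2) by (apply cv_disk_affine; auto).
  set (kappa := (1 - Cmod z) / (1 + Cmod z) * (gam - lam)).
  assert (Hk : 0 < kappa).
  { apply Rmult_lt_0_compat; [apply Rdiv_lt_0_compat|]; lra. }
  assert (Base : forall r, 0 <= r <= Cmod z -> kappa <= Re (PS y2 (RtoC r))).
  { intros r Hr.
    assert (Hr1 : Cmod (RtoC r) < 1) by (rewrite Cmod_R_nonneg; lra).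
    assert (Hr2 : Cmod (RtoC r * u) = r) by (rewrite Cmod_mult, Cmod_R_nonneg, Hu; lra).
    set (p := rotated gam del lam c d e) in *.
    assert (E : PS y2 (RtoC r) = (RtoC lam + PS p (RtoC r * u))%C).
    { rewrite PS_shift, (PS_shift p) by (auto; lra).
      rewrite Hp0.
      replace (y2 0%nat) with (RtoC gam).
      2:{ unfold y2, y1, y, X, dcoef. rewrite Hc1, Hd1. apply C_eq; simpl; ring. }
      rewrite <- PS_rotate.
      replace (PS (fun n => y2 (S n)) (RtoC r)) with
         (u * PS (fun n => p (S n) * u ^ n)%C (RtoC r))%C.
      - rewrite RtoC_minus. ring.
      - rewrite <- PS_scal_coef;
          [|apply (cv_disk_rotate (fun n => p (S n))); auto using cv_disk_shift|auto].
        apply PS_ext. intros n. unfold p, rotated, y2, y1, y, X, dcoef, op_weight.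
        replace (RtoC ((INR (S n) + 1) ^ 2 * (gam + (del - gam) / 2 * INR (S n)))) with
          (RtoC (1 + 1 * INR (S n)) * RtoC (gam + (del - gam) / 2 * INR (S n))
            * RtoC (INR (S (S n))))%C
          by (rewrite <- !RtoC_mult; f_equal; rewrite (S_INR (S n)); ring).
        rewrite (Cpow_S u n). ring. }
    rewrite E. assert (Hh := harnack _ (RtoC r * u)%C Hp Hpos ltac:(lra)).
    rewrite Hr2, Hp0 in Hh. simpl (Re (RtoC (gam - lam))) in Hh.
    change (kappa <= lam + Re (PS p (RtoC r * u))).
    assert (kappa <= (1 - r) / (1 + r) * (gam - lam)); [|lra].
    apply Rmult_le_compat_r; [lra|]. unfold Rdiv.
    apply Rmult_le_compat; [lra| |lra|].
    - apply Rlt_le, Rinv_0_lt_compat; lra.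
    - apply Rinv_le_contravar; lra. }
  assert (B1 := euler_minimum_PS y1 1 1 kappa (Cmod z) Hy1 ltac:(lra) ltac:(lra) ltac:(lra) Base).
  assert (B0 := euler_minimum_PS y gam ((del - gam) / 2) kappa (Cmod z) Hy ltac:(lra) ltac:(lra) ltac:(lra)).
  assert (B : kappa <= gam * Re (PS y (RtoC (Cmod z)))).
  { apply B0; [|lra]. intros r Hr. specialize (B1 r Hr). fold y1. lra. }
  unfold y in B. rewrite PS_rotate, Ez in B. nra.
Qed.

Lemma rotate_down (A B : C) : exists e, Cmod e = 1 /\ Re (A + e * B)%C = Re A - Cmod B.
Proof.
  destruct (phase B) as [u [Hu E]]. exists (- u)%C. split; [rewrite Cmod_opp; auto|].
  replace (- u * B)%C with (- (u * B))%C by ring. rewrite E. simpl. unfold Re; simpl. ring.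
Qed.

Lemma derivative_dominates gam del lam c d z :
  0 < gam <= del -> 0 <= lam < gam -> coef_class gam del lam c d -> Cmod z < 1 ->
  Cmod (PS (dcoef d) z) < Re (PS (dcoef c) z).
Proof.
  intros Hg Hl H Hz.
  destruct (rotate_down (PS (dcoef c) z) (PS (dcoef d) z)) as [e [He E]].
  pose proof (rotated_derivative_pos _ _ _ _ _ e z Hg Hl H He Hz). lra.
Qed.

(** The modulus of [h + conj g] is at least [|h| - |g|], which a suitable
    rotation [e] bounds below by [|z| Re ((h + e g) / z)]. *)
Lemma growth_lower_bound gam del lam c d z :
  0 < gam <= del -> lam < gam -> coef_class gam del lam c d ->
  c 0%nat = RtoC 0 -> d 0%nat = RtoC 0 -> Cmod z < 1 ->
  Cmod z * Re (extremal_PS gam del lam (RtoC (- Cmod z)))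
  <= Cmod (PS c z + Cconj (PS d z)).
Proof.
  intros Hg Hl H Hc0 Hd0 Hz.
  assert (Hc := proj1 H). assert (Hd := proj1 (proj2 H)).
  rewrite (PS_shift c), (PS_shift d), Hc0, Hd0, !Cplus_0_l by auto.
  set (A := PS _ z). set (B := PS _ z).
  destruct (rotate_down A B) as [e [He E]].
  pose proof (rotated_lower_bound _ _ _ _ _ e z Hg Hl H He Hz) as L.
  rewrite PS_plus_coef, (PS_scal_coef e (fun n => d (S n))) in L
    by auto using cv_disk_scal, cv_disk_shift.
  fold A B in L. rewrite E in L.
  pose proof (Re_le_Cmod A).
  pose proof (Cmod_triangle_rev (z * A) (Cconj (z * B))) as T.
  rewrite Cmod_conj, !Cmod_mult in T.
  pose proof (Cmod_ge_0 z).
  eapply Rle_trans; [|exact T]. rewrite <- Rmult_minus_distr_l.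
  apply Rmult_le_compat_l; lra.
Qed.

(** * The image of the disk *)

Lemma Cmod_le_abs (x y : R) : Cmod (x, y) <= Rabs x + Rabs y.
Proof.
  replace (x, y) with (RtoC x + Ci * RtoC y)%C by (apply C_eq; simpl; ring).
  eapply Rle_trans; [apply Cmod_triangle|].
  rewrite Cmod_mult, Cmod_Ci, !Cmod_R. lra.
Qed.

(** If the infimum were not attained, a finite cover of the disk would keep
    [phi] uniformly above it. *)
Lemma disk_min (phi : C -> R) rho : 0 <= rho ->
  (forall z, 0 <= phi z) ->
  (forall z, Cmod z <= rho -> forall eps, 0 < eps -> exists delta, 0 < delta /\
     forall y, Cmod y <= rho -> Cmod (y - z) < delta -> Rabs (phi y - phi z) < eps) ->
  exists m, Cmod m <= rho /\ forall y, Cmod y <= rho -> phi m <= phi y.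
Proof.
  intros Hrho Hpos Hc.
  destruct (completeness (fun x => exists z, Cmod z <= rho /\ x = - phi z)) as [M [Hub Hlub]].
  { exists 0. intros x [z [_ ->]]. specialize (Hpos z). lra. }
  { exists (- phi (RtoC 0)), (RtoC 0). rewrite Cmod_0. auto. }
  assert (HM : forall z, Cmod z <= rho -> - M <= phi z).
  { intros z Hz. assert (- phi z <= M) by (apply Hub; eauto). lra. }
  destruct (classic (exists m, Cmod m <= rho /\ phi m = - M)) as [[m [Hm E]]|Hno].
  { exists m. split; auto. intros y Hy. rewrite E. auto. }
  exfalso.
  (* Every point of the plane has a square on which [phi] stays away from its
     infimum, by the same amount as the size of the square. *)
  assert (Hloc : forall x y, exists delta : posreal, forall x' y',
     Rabs (x' - x) < delta -> Rabs (y' - y) < delta -> Cmod (x', y') <= rho ->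
     - M + delta <= phi (x', y')).
  { intros x y.
    assert (Hd : forall x' y', Cmod ((x', y') - (x, y)) <= Rabs (x' - x) + Rabs (y' - y))
      by (intros; apply Cmod_le_abs).
    destruct (Rle_lt_dec (Cmod (x, y)) rho) as [Hin|Hout].
    - assert (Hgap : - M < phi (x, y)).
      { destruct (Rle_lt_or_eq_dec _ _ (HM _ Hin)); auto. exfalso; eauto. }
      destruct (Hc _ Hin ((phi (x, y) + M) / 2) ltac:(lra)) as [d [Hd0 Hd1]].
      assert (Hmin : 0 < Rmin (d / 2) ((phi (x, y) + M) / 2)) by (apply Rmin_pos; lra).
      exists (mkposreal _ Hmin). simpl. intros x' y' Hx Hy Hr.
      pose proof (Rmin_l (d / 2) ((phi (x, y) + M) / 2)).
      pose proof (Rmin_r (d / 2) ((phi (x, y) + M) / 2)).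
      specialize (Hd x' y'). specialize (Hd1 _ Hr ltac:(lra)).
      apply Rabs_lt_between in Hd1. lra.
    - assert (Hmin : 0 < (Cmod (x, y) - rho) / 2) by lra.
      exists (mkposreal _ Hmin). simpl. intros x' y' Hx Hy Hr. exfalso.
      specialize (Hd x' y').
      pose proof (Cmod_triangle_minus (x', y') ((x', y') - (x, y))) as T.
      replace ((x', y') - ((x', y') - (x, y)))%C with (x, y) in T by (apply C_eq; simpl; ring).
      lra. }
  destruct (choice (fun (p : R * R) (delta : posreal) => forall x' y',
     Rabs (x' - fst p) < delta -> Rabs (y' - snd p) < delta -> Cmod (x', y') <= rho ->
     - M + delta <= phi (x', y'))) as [delta Hdelta].
  { intros [x y]. apply Hloc. }
  destruct (compactness_value_2d (- rho) rho (- rho) rho (fun x y => delta (x, y))) as [d Hd].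
  assert (Hall : forall z, Cmod z <= rho -> - M + d <= phi z).
  { intros [x y] Hz. apply Rnot_lt_le. intros Hlt.
    pose proof (Rmax_Cmod (x, y)) as Hxy. simpl in Hxy.
    pose proof (Rmax_l (Rabs x) (Rabs y)). pose proof (Rmax_r (Rabs x) (Rabs y)).
    apply (Hd x y).
    - apply Rabs_le_between; lra.
    - apply Rabs_le_between; lra.
    - intros (u & v & _ & _ & Hu & Hv & Hdd).
      specialize (Hdelta (u, v) x y Hu Hv Hz). simpl in Hdelta. lra. }
  assert (M <= M - d); [|pose proof (cond_pos d); lra].
  apply Hlub. intros x [z [Hz ->]]. specialize (Hall z Hz). lra.
Qed.

Lemma PS_lipschitz_at c rho z : cv_disk c -> rho < 1 -> Cmod z <= rho ->
  exists L, 0 <= L /\ forall y, Cmod y <= rho -> Cmod (PS c y - PS c z) <= L * Cmod (y - z).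
Proof.
  intros Hc Hrho Hz. pose proof (Cmod_ge_0 z).
  destruct (PS_second_order c rho Hc ltac:(lra)) as [M [HM H2]].
  exists (Cmod (PS (dcoef c) z) + M * 2). split.
  { pose proof (Cmod_ge_0 (PS (dcoef c) z)). lra. }
  intros y Hy. specialize (H2 z (y - z)%C Hz).
  rewrite Cplus_minus_cancel in H2. specialize (H2 Hy).
  pose proof (Cmod_triangle_minus y z). pose proof (Cmod_ge_0 (y - z)).
  assert (M * Cmod (y - z) ^ 2 <= M * 2 * Cmod (y - z)).
  { simpl. rewrite Rmult_1_r, Rmult_assoc. apply Rmult_le_compat_l; auto.
    apply Rmult_le_compat_r; lra. }
  replace (PS c y - PS c z)%C
    with (PS (dcoef c) z * (y - z) + (PS c y - PS c z - PS (dcoef c) z * (y - z)))%C by ring.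
  eapply Rle_trans; [apply Cmod_triangle|]. rewrite Cmod_mult. lra.
Qed.

(** Were the value [u] missed, moving along [(u - f z1) / h' z1] would bring
    [f] closer to [u], because [h'] dominates [g']. *)
Lemma interior_min_attained c d rho u z1 : cv_disk c -> cv_disk d ->
  Cmod z1 < rho < 1 -> Cmod (PS (dcoef d) z1) < Cmod (PS (dcoef c) z1) ->
  (forall y, Cmod y <= rho ->
     Cmod (PS c z1 + Cconj (PS d z1) - u) <= Cmod (PS c y + Cconj (PS d y) - u)) ->
  (PS c z1 + Cconj (PS d z1))%C = u.
Proof.
  intros Hc Hd Hz Hdom Hmin. pose proof (Cmod_ge_0 z1) as Hz0.
  destruct (PS_second_order c rho Hc ltac:(lra)) as [M1 [HM1 H1]].
  destruct (PS_second_order d rho Hd ltac:(lra)) as [M2 [HM2 H2]].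
  set (hp := PS (dcoef c) z1) in *. set (gp := PS (dcoef d) z1) in *.
  set (v := (u - (PS c z1 + Cconj (PS d z1)))%C).
  destruct (Req_dec (Cmod v) 0) as [Ev|Ev].
  { apply Cmod_eq_0 in Ev. replace u with (v + (PS c z1 + Cconj (PS d z1)))%C
      by (unfold v; ring). rewrite Ev; ring. }
  exfalso. assert (Hv : 0 < Cmod v) by (pose proof (Cmod_ge_0 v); lra).
  assert (Hg0 := Cmod_ge_0 gp).
  assert (Hhp : hp <> RtoC 0) by (intros F; rewrite F, Cmod_0 in Hdom; lra).
  set (zeta := (v / hp)%C). set (q := Cmod gp / Cmod hp).
  assert (Hq : 0 <= q < 1).
  { unfold q. split; [apply Rdiv_le_0_compat; lra|].
    apply Rmult_lt_reg_r with (Cmod hp); [lra|]. unfold Rdiv.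
    rewrite Rmult_assoc, Rinv_l by lra. lra. }
  assert (Hgz : Cmod (gp * zeta) = q * Cmod v).
  { unfold zeta. rewrite Cmod_mult, Cmod_div by auto. unfold q. field. lra. }
  set (B := (M1 + M2) * Cmod zeta ^ 2 + 1).
  assert (Hze := Cmod_ge_0 zeta).
  assert (HB : 0 < B).
  { unfold B. pose proof (pow2_ge_0 (Cmod zeta)). nra. }
  (* The step [t] stays in the disk by [t1], and by [t2] its second order error
     is at most half of the first order gain [t (1 - q) |v|]. *)
  set (t1 := (rho - Cmod z1) / (Cmod zeta + 1)). set (t2 := (1 - q) * Cmod v / (2 * B)).
  assert (Ht1 : 0 < t1) by (unfold t1; apply Rdiv_lt_0_compat; lra).
  assert (Ht2 : 0 < t2) by (unfold t2; apply Rdiv_lt_0_compat; [apply Rmult_lt_0_compat|]; lra).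
  set (t := Rmin (1 / 2) (Rmin t1 t2)).
  assert (Hta : t <= 1 / 2) by apply Rmin_l.
  assert (Htb : t <= t1) by (eapply Rle_trans; [apply Rmin_r|apply Rmin_l]).
  assert (Htc : t <= t2) by (eapply Rle_trans; [apply Rmin_r|apply Rmin_r]).
  assert (Ht : 0 < t) by (unfold t; repeat apply Rmin_pos; lra).
  set (w := (RtoC t * zeta)%C).
  assert (Hw : Cmod w = t * Cmod zeta) by (unfold w; rewrite Cmod_mult, Cmod_R_nonneg; lra).
  assert (Hw1 : Cmod w <= rho - Cmod z1).
  { rewrite Hw. apply Rle_trans with (t1 * Cmod zeta); [apply Rmult_le_compat_r; auto|].
    replace (rho - Cmod z1) with (t1 * (Cmod zeta + 1)) by (unfold t1; field; lra). nra. }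
  assert (Hin : Cmod (z1 + w) <= rho) by (pose proof (Cmod_triangle z1 w); lra).
  specialize (H1 z1 w ltac:(lra) Hin). specialize (H2 z1 w ltac:(lra) Hin).
  specialize (Hmin _ Hin). fold hp in H1. fold gp in H2.
  set (e1 := (PS c (z1 + w) - PS c z1 - hp * w)%C) in *.
  set (e2 := (PS d (z1 + w) - PS d z1 - gp * w)%C) in *.
  assert (E : (PS c (z1 + w) + Cconj (PS d (z1 + w)) - u)%C =
    (RtoC (t - 1) * v + (Cconj (gp * w) + (e1 + Cconj e2)))%C).
  { replace (Cconj (gp * w) + (e1 + Cconj e2))%C with
      (e1 + Cconj (gp * w + e2))%C by (rewrite Cplus_conj; ring).
    replace (gp * w + e2)%C with (PS d (z1 + w) - PS d z1)%C by (unfold e2; ring).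
    assert (Ehw : (hp * w)%C = (RtoC t * v)%C) by (unfold w, zeta; field; auto).
    unfold e1. rewrite Ehw, Cminus_conj, RtoC_minus. unfold v. ring. }
  assert (E0 : Cmod (PS c z1 + Cconj (PS d z1) - u) = Cmod v).
  { rewrite Cmod_minus_sym. auto. }
  rewrite E, E0 in Hmin.
  assert (T1 : Cmod (RtoC (t - 1) * v) = (1 - t) * Cmod v).
  { rewrite Cmod_mult, Cmod_R, Rabs_left1 by lra. ring. }
  assert (T2 : Cmod (Cconj (gp * w)) = t * (q * Cmod v)).
  { rewrite Cmod_conj, <- Hgz. unfold w.
    replace (gp * (RtoC t * zeta))%C with (RtoC t * (gp * zeta))%C by ring.
    rewrite Cmod_mult, Cmod_R_nonneg by lra. auto. }
  assert (T3 : Cmod (e1 + Cconj e2) <= t * (t * B)).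
  { eapply Rle_trans; [apply Cmod_triangle|]. rewrite Cmod_conj.
    rewrite Hw in H1, H2.
    replace (t * (t * B)) with ((M1 + M2) * (t * Cmod zeta) ^ 2 + t * t) by (unfold B; ring).
    nra. }
  assert (T4 : t * B <= (1 - q) * Cmod v / 2).
  { apply Rle_trans with (t2 * B); [apply Rmult_le_compat_r; lra|].
    unfold t2. apply Req_le. field. lra. }
  pose proof (Cmod_triangle (RtoC (t - 1) * v) (Cconj (gp * w) + (e1 + Cconj e2))) as T5.
  pose proof (Cmod_triangle (Cconj (gp * w)) (e1 + Cconj e2)) as T6.
  assert (t * (t * B) <= t * ((1 - q) * Cmod v / 2)) by (apply Rmult_le_compat_l; lra).
  assert (0 < t * ((1 - q) * Cmod v)) by (repeat apply Rmult_lt_0_compat; lra).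
  nra.
Qed.

Lemma locally_C_iff (w : C) (P : C -> Prop) :
  @locally C_UniformSpace w P <->
  exists delta, 0 < delta /\ forall y, Cmod (y - w) < delta -> P y.
Proof.
  split.
  - intros [e He]. exists e. split; [apply cond_pos|]. intros y Hy.
    apply He. apply C_NormedModule_mixin_compat1. exact Hy.
  - intros [d [Hd H]]. assert (Hd2 : 0 < d / 2) by lra.
    exists (mkposreal _ Hd2). intros y [Hy1 Hy2]. apply H.
    change (Rabs (fst y - fst w) < d / 2) in Hy1.
    change (Rabs (snd y - snd w) < d / 2) in Hy2.
    pose proof (Cmod_le_abs (fst y - fst w) (snd y - snd w)).
    change (Cmod (fst y - fst w, snd y - snd w) < d). lra.
Qed.

(** A boundary point [w] is a limit of values and of missed values. If it were
    closer to the origin than [D], a missed [u] near [w] would have a closest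
    value on a slightly smaller closed disk, necessarily at an interior point. *)
Lemma boundary_far (f : C -> C) c d D : cv_disk c -> cv_disk d ->
  (forall z, Cmod z < 1 -> f z = (PS c z + Cconj (PS d z))%C) ->
  (forall z, Cmod z < 1 -> Cmod (PS (dcoef d) z) < Cmod (PS (dcoef c) z)) ->
  (forall eta, 0 < eta -> exists rho, rho < 1 /\
     forall z, rho <= Cmod z < 1 -> D - eta <= Cmod (f z)) ->
  forall w, boundary (image_disk f) w -> D <= Cmod w.
Proof.
  intros Hc Hd Hf Hdom HD w [Hw1 Hw2]. apply Rnot_lt_le. intros Hlt.
  (* The values below lie within [3 eta] of [w], so their modulus is less than
     [D - eta]. *)
  set (eta := (D - Cmod w) / 8). assert (Heta : 0 < eta) by (unfold eta; lra).
  destruct (HD eta Heta) as [rho [Hrho1 Hrho]].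
  assert (Hzs : exists zs, Cmod zs < 1 /\ Cmod (f zs - w) < eta).
  { apply NNPP. intros Hno. apply Hw1. apply locally_C_iff. exists eta. split; auto.
    intros y Hy [z [Hz ->]]. apply Hno. exists z. auto. }
  assert (Hu : exists u, Cmod (u - w) < eta /\ ~ image_disk f u).
  { apply NNPP. intros Hno. apply Hw2. apply locally_C_iff. exists eta. split; auto.
    intros y Hy. apply NNPP. intros Hy2. apply Hno. eauto. }
  destruct Hzs as [zs [Hzs1 Hzs2]]. destruct Hu as [u [Hu1 Hu2]].
  assert (Tri : forall x, Cmod x <= Cmod w + Cmod (x - w)).
  { intros x. pose proof (Cmod_triangle w (x - w)). rewrite Cplus_minus_cancel in H. auto. }
  assert (Hzr : Cmod zs < rho).
  { apply Rnot_le_lt. intros H. specialize (Hrho zs (conj H Hzs1)).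
    specialize (Tri (f zs)). unfold eta in *. lra. }
  pose proof (Cmod_ge_0 zs).
  destruct (disk_min (fun z => Cmod (PS c z + Cconj (PS d z) - u)) rho) as [m [Hm1 Hm2]];
    [lra|intros; apply Cmod_ge_0| |].
  { intros z Hz eps Heps.
    destruct (PS_lipschitz_at c rho z Hc Hrho1 Hz) as [L1 [HL1 H1]].
    destruct (PS_lipschitz_at d rho z Hd Hrho1 Hz) as [L2 [HL2 H2]].
    exists (eps / (L1 + L2 + 1)). split; [apply Rdiv_lt_0_compat; lra|].
    intros y Hy Hyz. specialize (H1 y Hy). specialize (H2 y Hy).
    assert (Hbd : Cmod ((PS c y + Cconj (PS d y) - u) - (PS c z + Cconj (PS d z) - u)) < eps).
    { replace ((PS c y + Cconj (PS d y) - u) - (PS c z + Cconj (PS d z) - u))%C with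
        ((PS c y - PS c z) + Cconj (PS d y - PS d z))%C by (rewrite Cminus_conj; ring).
      eapply Rle_lt_trans; [apply Cmod_triangle|]. rewrite Cmod_conj.
      apply Rle_lt_trans with ((L1 + L2 + 1) * Cmod (y - z)).
      - pose proof (Cmod_ge_0 (y - z)). lra.
      - apply (Rmult_lt_compat_l (L1 + L2 + 1)) in Hyz; [|lra].
        replace ((L1 + L2 + 1) * (eps / (L1 + L2 + 1))) with eps in Hyz by (field; lra). auto. }
    set (A := (PS c y + Cconj (PS d y) - u)%C) in *.
    set (B := (PS c z + Cconj (PS d z) - u)%C) in *.
    pose proof (Cmod_triangle_rev A (- B)) as R1. pose proof (Cmod_triangle_rev B (- A)) as R2.
    rewrite Cmod_opp in R1, R2.
    change (A + - B)%C with (A - B)%C in R1. change (B + - A)%C with (B - A)%C in R2.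
    rewrite (Cmod_minus_sym B A) in R2. apply Rabs_lt_between. lra. }
  assert (Hm3 : Cmod (PS c m + Cconj (PS d m) - u) < 2 * eta).
  { eapply Rle_lt_trans; [apply (Hm2 zs); lra|]. rewrite <- Hf by auto.
    replace (f zs - u)%C with ((f zs - w) - (u - w))%C by ring.
    pose proof (Cmod_triangle_minus (f zs - w) (u - w)). lra. }
  assert (Hm4 : Cmod m < rho).
  { destruct (Rle_lt_or_eq_dec _ _ Hm1) as [|E]; auto. exfalso.
    assert (Hm5 : rho <= Cmod m < 1) by lra. specialize (Hrho m Hm5).
    rewrite Hf in Hrho by lra.
    pose proof (Cmod_triangle (PS c m + Cconj (PS d m) - u) u) as T.
    replace (PS c m + Cconj (PS d m) - u + u)%C with (PS c m + Cconj (PS d m))%C in T by ring.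
    specialize (Tri u). unfold eta in *. lra. }
  apply Hu2. exists m. split; [unfold in_disk; lra|].
  rewrite Hf by lra. symmetry.
  apply (interior_min_attained c d rho); auto.
  apply Hdom. lra.
Qed.

(** * Boundary values of the extremal series *)

(** A telescoping majorant, which makes the extremal series converge absolutely
    on the closed disk. *)
Lemma extremal_le gam del lam n : lam < gam -> 0 < gam <= del ->
  extremal gam del lam (S n) <= 4 * (gam - lam) / gam * (/ (INR n + 1) - / (INR n + 2)).
Proof.
  intros Hl Hg. unfold extremal. pose proof (pos_INR n).
  replace (4 * (gam - lam) / gam * (/ (INR n + 1) - / (INR n + 2)))
    with (4 * (gam - lam) / (gam * ((INR n + 1) * (INR n + 2)))) by (field; lra).
  apply Rmult_le_compat_l; [lra|]. apply Rinv_le_contravar.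
  - apply Rmult_lt_0_compat; [lra|]. nra.
  - eapply Rle_trans; [|apply denom_ge; auto]. rewrite !S_INR.
    apply Rle_trans with (gam * (2 * (INR n + 1 + 1) ^ 2)); [|lra].
    apply Rmult_le_compat_l; nra.
Qed.

Lemma extremal_summable gam del lam : lam < gam -> 0 < gam <= del ->
  ex_series (extremal gam del lam).
Proof.
  intros Hl Hg. apply ex_series_incr_1.
  apply ex_series_bound with
    (fun n => 4 * (gam - lam) / gam * (/ (INR n + 1) - / (INR n + 2))).
  - intros n. rewrite Rabs_pos_eq by (apply Rlt_le, extremal_pos; auto).
    apply extremal_le; auto.
  - apply (ex_series_scal (4 * (gam - lam) / gam) (fun n => / (INR n + 1) - / (INR n + 2))).
    exists 1. change (is_lim_seq (sum_n (fun n => / (INR n + 1) - / (INR n + 2))) 1).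
    apply (is_lim_seq_ext (fun n => 1 - / (INR (S (S n))))).
    + intros n. induction n.
      * rewrite sum_O. simpl. lra.
      * rewrite sum_Sn, <- IHn. unfold plus; simpl (AbelianMonoid.plus _ _).
        rewrite !S_INR. replace (INR n + 1 + 2) with (INR n + 1 + 1 + 1) by ring. lra.
    + replace (Finite 1) with (Rbar_minus 1 0) by (simpl; f_equal; ring).
      apply is_lim_seq_minus'; [apply is_lim_seq_const|].
      apply (is_lim_seq_incr_1 (fun n => / INR (S n))), (is_lim_seq_incr_1 (fun n => / INR n)).
      replace (Finite 0) with (Rbar_inv p_infty) by reflexivity.
      apply is_lim_seq_inv; [apply is_lim_seq_INR | discriminate].
Qed.

Lemma one_minus_pow r n : 0 <= r <= 1 -> 0 <= 1 - r ^ n <= INR n * (1 - r).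
Proof.
  intros Hr. induction n; [simpl; lra|].
  rewrite S_INR. simpl.
  assert (0 <= r ^ n <= 1).
  { split; [apply pow_le; lra|]. rewrite <- (pow1 n). apply pow_incr; lra. }
  nra.
Qed.

(** Abel's limit theorem for absolutely summable coefficients: a term of index at
    most [N] moves by at most the fraction [N (1 - r)], and the others form a
    small tail. *)
Lemma abel_absolute (A : nat -> R) eta : ex_series (fun n => Rabs (A n)) -> 0 < eta ->
  exists rho, 0 <= rho < 1 /\ forall r, rho <= r < 1 ->
    Rabs (Series (fun n => A n * r ^ n) - Series A) < eta.
Proof.
  intros HA Heta.
  destruct (series_tail_small _ (eta / 2) HA ltac:(lra)) as [N HN].
  specialize (HN (S N) ltac:(lia)).
  set (K := Series (fun n => Rabs (A n))).
  assert (HK : 0 <= K) by (apply Series_nonneg; auto; intros; apply Rabs_pos).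
  pose proof (pos_INR (S N)) as HNp.
  assert (HKN : 0 <= K * INR (S N)) by (apply Rmult_le_pos; auto).
  set (x := eta / (2 * (K * INR (S N) + 1))).
  assert (Hx : 0 < x) by (apply Rdiv_lt_0_compat; lra).
  exists (Rmax 0 (1 - x)). split.
  { split; [apply Rmax_l|]. apply Rmax_lub_lt; lra. }
  intros r [Hr1 Hr2].
  pose proof (Rmax_l 0 (1 - x)). pose proof (Rmax_r 0 (1 - x)).
  assert (Hr : 0 <= r <= 1) by lra.
  assert (Hp : forall n, 0 <= r ^ n <= 1).
  { intros n. destruct (one_minus_pow r n Hr).
    split; [apply pow_le; lra|lra]. }
  assert (Hex : ex_series (fun n => A n * r ^ n)).
  { apply ex_series_bound with (2 := HA). intros n. rewrite Rabs_mult.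
    destruct (Hp n). rewrite (Rabs_pos_eq (r ^ n)) by auto.
    pose proof (Rabs_pos (A n)). nra. }
  rewrite <- Series_minus by (auto using ex_series_Rabs).
  set (tail := fun n => if Compare_dec.le_dec (S N) n then Rabs (A n) else 0).
  assert (Htail : ex_series tail).
  { apply ex_series_bound with (2 := HA). intros n. unfold tail.
    destruct (Compare_dec.le_dec (S N) n).
    - rewrite Rabs_Rabsolu; lra.
    - rewrite Rabs_R0; apply Rabs_pos. }
  assert (Htail2 : Series tail < eta / 2).
  { rewrite (Series_incr_n_aux tail (S N)).
    - rewrite (Series_ext _ (fun n => Rabs (A (S N + n)%nat))).
      + eapply Rle_lt_trans; [apply Rle_abs|exact HN].
      + intros n. unfold tail. destruct (Compare_dec.le_dec (S N) (S N + n)); [auto|lia].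
    - intros k Hk. unfold tail. destruct (Compare_dec.le_dec (S N) k); [lia|auto]. }
  set (b := fun n => INR (S N) * (1 - r) * Rabs (A n) + tail n).
  assert (Hb : ex_series b).
  { apply (ex_series_plus (fun n => INR (S N) * (1 - r) * Rabs (A n)) tail); auto.
    exact (ex_series_scal (INR (S N) * (1 - r)) _ HA). }
  assert (Hle : forall n, Rabs (A n * r ^ n - A n) <= b n).
  { intros n. replace (A n * r ^ n - A n) with (- (A n * (1 - r ^ n))) by ring.
    rewrite Rabs_Ropp, Rabs_mult. destruct (one_minus_pow r n Hr) as [P1 P2].
    destruct (Hp n) as [P3 P4].
    rewrite (Rabs_pos_eq (1 - r ^ n)) by auto.
    pose proof (Rabs_pos (A n)). unfold b, tail.
    assert (0 <= INR (S N) * (1 - r)) by (apply Rmult_le_pos; lra).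
    destruct (Compare_dec.le_dec (S N) n) as [Hn|Hn].
    - nra.
    - assert (INR n <= INR (S N)) by (apply le_INR; lia).
      assert (INR n * (1 - r) <= INR (S N) * (1 - r)) by (apply Rmult_le_compat_r; lra). nra. }
  assert (Hab : ex_series (fun n => Rabs (A n * r ^ n - A n))).
  { apply ex_series_bound with (2 := Hb). intros n. rewrite Rabs_Rabsolu. auto. }
  eapply Rle_lt_trans; [apply Series_Rabs; exact Hab|].
  eapply Rle_lt_trans; [apply Series_le with (2 := Hb); intros n; split;
    [apply Rabs_pos|apply Hle]|].
  unfold b. rewrite Series_plus, Series_scal_l; auto.
  2:{ exact (ex_series_scal (INR (S N) * (1 - r)) _ HA). }
  fold K.
  assert (INR (S N) * (1 - r) * K <= K * INR (S N) * x).
  { replace (INR (S N) * (1 - r) * K) with (K * INR (S N) * (1 - r)) by ring.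
    apply Rmult_le_compat_l; lra. }
  assert (x * (K * INR (S N) + 1) = eta / 2) by (unfold x; field; lra).
  lra.
Qed.

(** The distance from the origin to the boundary of the extremal image:
    [d* = - extremal_fun (- 1)]. *)
Definition extremal_dist (gam del lam : R) : R :=
  Series (fun n => extremal gam del lam n * (-1) ^ n).

Lemma Rabs_sign n x : 0 <= x -> Rabs (x * (-1) ^ n) = x.
Proof. intros Hx. rewrite Rabs_mult, pow_1_abs, Rmult_1_r. apply Rabs_pos_eq; auto. Qed.

Lemma extremal_alt_summable gam del lam : lam < gam -> 0 < gam <= del ->
  ex_series (fun n => Rabs (extremal gam del lam n * (-1) ^ n)).
Proof.
  intros Hl Hg. apply ex_series_ext with (extremal gam del lam).
  - intros n. rewrite Rabs_sign; auto. apply Rlt_le, extremal_pos; auto.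
  - apply extremal_summable; auto.
Qed.

Lemma extremal_limit gam del lam eta : lam < gam -> 0 < gam <= del -> 0 < eta ->
  exists rho, 0 <= rho < 1 /\ forall r, rho <= r < 1 ->
    Rabs (r * Re (extremal_PS gam del lam (RtoC (- r))) - extremal_dist gam del lam) < eta.
Proof.
  intros Hl Hg Heta.
  destruct (abel_absolute _ (eta / 2) (extremal_alt_summable _ _ _ Hl Hg) ltac:(lra))
    as [rho [Hrho H]].
  fold (extremal_dist gam del lam) in H.
  set (D := extremal_dist gam del lam) in *.
  set (x := eta / (2 * (Rabs D + eta))).
  pose proof (Rabs_pos D).
  assert (Hx : 0 < x) by (apply Rdiv_lt_0_compat; lra).
  exists (Rmax rho (1 - x)). split.
  { split; [eapply Rle_trans; [|apply Rmax_l]; lra|apply Rmax_lub_lt; lra]. }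
  intros r [Hr1 Hr2]. pose proof (Rmax_l rho (1 - x)). pose proof (Rmax_r rho (1 - x)).
  specialize (H r ltac:(lra)).
  unfold extremal_PS. rewrite Re_PS_real. unfold PSeries.
  rewrite (Series_ext _ (fun n => extremal gam del lam n * (-1) ^ n * r ^ n))
    by (intros n; simpl; replace (- r) with (-1 * r) by ring; rewrite Rpow_mult_distr; ring).
  set (T := Series _) in *.
  assert (HT : Rabs T <= Rabs D + eta / 2).
  { replace T with ((T - D) + D) by ring. eapply Rle_trans; [apply Rabs_triang|]. lra. }
  replace (r * T - D) with ((T - D) - (1 - r) * T) by ring.
  eapply Rle_lt_trans; [apply Rabs_triang|]. rewrite Rabs_Ropp, Rabs_mult.
  rewrite (Rabs_pos_eq (1 - r)) by lra.
  assert ((1 - r) * Rabs T < eta / 2); [|lra].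
  apply Rle_lt_trans with (x * (Rabs D + eta / 2)).
  - apply Rmult_le_compat; try lra. apply Rabs_pos.
  - assert (x * (Rabs D + eta) = eta / 2) by (unfold x; field; lra). nra.
Qed.

(** * The radius *)

Lemma extremal_decreasing gam del lam : 0 <= lam < gam -> 0 < gam <= del ->
  Un_decreasing (extremal gam del lam).
Proof.
  intros Hl Hg n. unfold extremal.
  assert (Hd := denom_pos gam del (S n) Hg).
  destruct n as [|n].
  - apply Rmult_le_reg_r with (denom gam del 2); auto.
    unfold Rdiv. rewrite Rmult_assoc, Rinv_l by lra. unfold denom. simpl. nra.
  - apply Rmult_le_compat_l; [lra|].
    apply Rinv_le_contravar; [apply denom_pos; auto|].
    unfold denom. rewrite (S_INR (S (S n))). set (m := INR (S (S n))).
    assert (Hm : 1 <= m) by (unfold m; rewrite S_INR; pose proof (pos_INR (S n)); lra).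
    assert (0 <= (del - gam) * (m - 1)) by (apply Rmult_le_pos; lra).
    apply Rmult_le_compat; nra.
Qed.

Lemma extremal_1 gam del lam : 0 <= lam < gam -> 0 < gam <= del ->
  0 < extremal gam del lam 1 < 1.
Proof.
  intros Hl Hg. split; [apply extremal_pos; lra|].
  unfold extremal. assert (Hd := denom_pos gam del 1 Hg).
  apply Rmult_lt_reg_r with (denom gam del 2); auto.
  unfold Rdiv. rewrite Rmult_assoc, Rinv_l by lra. unfold denom. simpl. nra.
Qed.

(** The partial sums of an alternating series with decreasing terms enclose its
    sum, and the first two here are [1] and [1 - E_1]. *)
Lemma extremal_dist_bounds gam del lam : 0 <= lam < gam -> 0 < gam <= del ->
  0 < extremal_dist gam del lam <= 1.
Proof.
  intros Hl Hg.
  assert (Hs := extremal_summable gam del lam (proj2 Hl) Hg).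
  assert (Ha := ex_series_Rabs _ (extremal_alt_summable gam del lam (proj2 Hl) Hg)).
  pose proof (extremal_1 gam del lam Hl Hg) as H1.
  destruct (alternated_series_ineq (extremal gam del lam) (extremal_dist gam del lam) 0) as [L U].
  - apply extremal_decreasing; auto.
  - apply is_lim_seq_Reals, ex_series_lim_0; auto.
  - apply is_lim_seq_Reals.
    apply (is_lim_seq_ext (sum_n (fun n => extremal gam del lam n * (-1) ^ n))).
    + intros n. rewrite sum_n_Reals. apply sum_eq. intros. unfold tg_alt. ring.
    + exact (Series_correct _ Ha).
  - replace (sum_f_R0 (tg_alt (extremal gam del lam)) (2 * 0)) with 1 in U
      by (unfold tg_alt; simpl; ring).
    replace (sum_f_R0 (tg_alt (extremal gam del lam)) (S (2 * 0)))
      with (1 - extremal gam del lam 1) in L by (unfold tg_alt; simpl; ring).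
    lra.
Qed.

(** [r + 2 sum E_(m-1) r^m], the value of the left-hand side of the Bohr inequality
    for the extremal function at [z = r]. *)
Definition bohr_value (gam del lam r : R) : R :=
  2 * (r * PSeries (extremal gam del lam) r) - r.

Lemma extremal_radius gam del lam r : lam < gam -> 0 < gam <= del -> 0 <= r < 1 ->
  Rbar_lt (Rabs r) (CV_radius (extremal gam del lam)).
Proof.
  intros Hl Hg Hr. apply Rbar_lt_le_trans with 1.
  - simpl. rewrite Rabs_pos_eq; lra.
  - apply (cv_disk_radius _ _ (extremal_cv gam del lam Hl Hg)).
    intros n. rewrite Cmod_R. lra.
Qed.

Lemma bohr_value_series gam del lam r : lam < gam -> 0 < gam <= del -> 0 <= r < 1 ->
  bohr_value gam del lam r
  = r + 2 * Series (fun k => extremal gam del lam (S k) * r ^ (k + 2)).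
Proof.
  intros Hl Hg Hr. unfold bohr_value.
  rewrite PSeries_decr_1 by (apply CV_radius_inside, extremal_radius; auto).
  rewrite (Series_ext _ (fun k => r * (r * (PS_decr_1 (extremal gam del lam) k * r ^ k)))).
  - rewrite !Series_scal_l. unfold PSeries. simpl (extremal gam del lam 0). ring.
  - intros n. unfold PS_decr_1. rewrite pow_add. simpl. ring.
Qed.

Lemma radius_equation_iff gam del lam r : lam < gam -> 0 < gam <= del -> 0 <= r < 1 ->
  radius_equation gam del lam r <-> bohr_value gam del lam r = extremal_dist gam del lam.
Proof.
  intros Hl Hg Hr. rewrite bohr_value_series by auto.
  unfold radius_equation, Series_from2.
  assert (E1 : 8 * (gam - lam) * Series (fun k => r ^ (k + 2) / denom gam del (k + 2))
    = 2 * Series (fun k => extremal gam del lam (S k) * r ^ (k + 2))).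
  { rewrite <- !Series_scal_l. apply Series_ext. intros n.
    replace (n + 2)%nat with (S (S n)) by lia. unfold extremal.
    field. pose proof (denom_pos gam del (S n) Hg). lra. }
  assert (E2 : 1 + 4 * (gam - lam) * Series (fun k => (-1) ^ (k + 2 - 1) / denom gam del (k + 2))
    = extremal_dist gam del lam).
  { unfold extremal_dist.
    rewrite (Series_incr_1 (fun n => extremal gam del lam n * (-1) ^ n)) by (apply ex_series_Rabs, extremal_alt_summable; auto).
    f_equal; [simpl; ring|]. rewrite <- Series_scal_l. apply Series_ext. intros n.
    replace (n + 2 - 1)%nat with (S n) by lia.
    replace (n + 2)%nat with (S (S n)) by lia. unfold extremal.
    field. pose proof (denom_pos gam del (S n) Hg). lra. }
  rewrite E1. split; intros H; lra.
Qed.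

Lemma extremal_tail_summable gam del lam s : lam < gam -> 0 < gam <= del -> 0 <= s < 1 ->
  ex_series (fun k => extremal gam del lam (S k) * s ^ (k + 2)).
Proof.
  intros Hl Hg Hs. assert (H := extremal_cv gam del lam Hl Hg s Hs).
  apply (ex_series_incr_1 (fun n => Cmod (RtoC (extremal gam del lam n)) * s ^ n)) in H.
  eapply ex_series_ext; [|exact (ex_series_scal s _ H)]. intros n.
  change (s * (Cmod (RtoC (extremal gam del lam (S n))) * s ^ (S n))
    = extremal gam del lam (S n) * s ^ (n + 2)).
  rewrite Cmod_R_nonneg by (apply Rlt_le, extremal_pos; auto).
  rewrite pow_add. cbn [pow]. ring.
Qed.

Lemma bohr_value_increasing gam del lam r s : lam < gam -> 0 < gam <= del ->
  0 <= r -> r < s -> s < 1 -> bohr_value gam del lam r < bohr_value gam del lam s.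
Proof.
  intros Hl Hg Hr Hrs Hs. rewrite !bohr_value_series by (auto; lra).
  assert (Series (fun k => extremal gam del lam (S k) * r ^ (k + 2))
    <= Series (fun k => extremal gam del lam (S k) * s ^ (k + 2))); [|lra].
  apply Series_le.
  - intros n. pose proof (extremal_pos gam del lam (S n) Hl Hg). split.
    + apply Rmult_le_pos; [lra|apply pow_le; auto].
    + apply Rmult_le_compat_l; [lra|]. apply pow_incr; lra.
  - apply extremal_tail_summable; auto; lra.
Qed.

Lemma bohr_value_large gam del lam : 0 <= lam < gam -> 0 < gam <= del ->
  exists r, 0 < r < 1 /\ extremal_dist gam del lam < bohr_value gam del lam r.
Proof.
  intros Hl Hg. pose proof (extremal_1 gam del lam Hl Hg) as H1.
  set (E1 := extremal gam del lam 1) in *.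
  (* For this [r], [r + 2 E1 r^2 = (1 + 3 E1) / (1 + E1)^2], which exceeds [1]
     because [E1 < 1]. *)
  exists (/ (1 + E1)).
  assert (Hr : 0 < / (1 + E1) < 1).
  { split; [apply Rinv_0_lt_compat; lra|]. rewrite <- Rinv_1.
    apply Rinv_lt_contravar; lra. }
  split; auto. set (r := / (1 + E1)) in *.
  apply Rle_lt_trans with 1; [apply extremal_dist_bounds; auto|].
  rewrite bohr_value_series by (auto; lra).
  assert (E1 * r ^ 2 <= Series (fun k => extremal gam del lam (S k) * r ^ (k + 2))).
  { assert (Hex := extremal_tail_summable gam del lam r (proj2 Hl) Hg ltac:(lra)).
    rewrite Series_incr_1 by auto. simpl (0 + 2)%nat. fold E1.
    assert (0 <= Series (fun k => extremal gam del lam (S (S k)) * r ^ (S k + 2))); [|lra].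
    apply Series_nonneg.
    - intros n. apply Rmult_le_pos; [apply Rlt_le, extremal_pos; lra|apply pow_le; lra].
    - apply (ex_series_incr_1 (fun k => extremal gam del lam (S k) * r ^ (k + 2))); auto. }
  assert (Er : (1 + E1) * r = 1) by (unfold r; field; lra).
  assert (E1 * r < 1 / 2 * (1 + E1) * r) by nra. 
  nra.
Qed.

Lemma radius_exists gam del lam : 0 <= lam < gam -> 0 < gam <= del ->
  exists R1, 0 < R1 < 1 /\ bohr_value gam del lam R1 = extremal_dist gam del lam.
Proof.
  intros Hl Hg. destruct (bohr_value_large gam del lam Hl Hg) as [s [Hs1 Hs2]].
  pose proof (extremal_dist_bounds gam del lam Hl Hg).
  set (phi := fun r => bohr_value gam del lam r - extremal_dist gam del lam).
  destruct (Ranalysis5.IVT_interv phi 0 s) as [R1 [H1 H2]].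
  - intros r Hr. unfold phi, bohr_value. apply derivable_continuous_pt, ex_derive_Reals_0.
    assert (ex_derive (PSeries (extremal gam del lam)) r)
      by (apply ex_derive_PSeries, extremal_radius; lra).
    auto_derive. auto.
  - lra.
  - unfold phi, bohr_value. lra.
  - unfold phi. lra.
  - exists R1. assert (R1 <> 0).
    { intros ->. unfold phi, bohr_value in H2. lra. }
    split; [lra|]. unfold phi in H2. lra.
Qed.

(** * Bohr's inequality up to the radius *)

Lemma coef_class_of_RH0 gam del lam h g a b :
  RH0 gam del lam h g -> coefficients h g a b ->
  coef_class gam del lam (head2 1 a) (head2 0 b) /\
  forall z, Cmod z < 1 -> h z = PS (head2 1 a) z /\ g z = PS (head2 0 b) z.
Proof.
  intros [_ HR] [Ha Hb].
  destruct (expansion_PS 1 _ _ Ha) as [Hc Ec]. destruct (expansion_PS 0 _ _ Hb) as [Hd Ed].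
  assert (Eh : forall z, Cmod z < 1 -> h z = PS (head2 1 a) z)
    by (intros z Hz; rewrite Ec by auto; ring).
  assert (Eg : forall z, Cmod z < 1 -> g z = PS (head2 0 b) z)
    by (intros z Hz; rewrite Ed by auto; ring).
  split; [|auto]. repeat split; auto. intros z Hz.
  specialize (HR z Hz).
  rewrite (diff_op_PS gam del h _ Hc Eh z Hz), (diff_op_PS gam del g _ Hd Eg z Hz) in HR.
  change (Re (PS (op_coef gam del (head2 1 a)) z) + - lam
    > Cmod (PS (op_coef gam del (head2 0 b)) z)) in HR. lra.
Qed.

Lemma dist_lower_bound gam del lam h g a b :
  0 <= lam < gam -> gam <= del -> RH0 gam del lam h g -> coefficients h g a b ->
  Rbar_le (extremal_dist gam del lam)
    (dist_to (harm h g (RtoC 0)) (boundary (image_disk (harm h g)))).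
Proof.
  intros Hl Hg HR Hab. assert (Hg' : 0 < gam <= del) by lra.
  destruct (coef_class_of_RH0 _ _ _ _ _ _ _ HR Hab) as [Hcl E].
  assert (Hc := proj1 Hcl). assert (Hd := proj1 (proj2 Hcl)).
  destruct HR as [(_ & _ & Hh0 & _ & Hg0 & _) _].
  unfold dist_to. apply (proj2 (Glb_Rbar_correct _)). intros x [w [Hw ->]].
  unfold harm at 1. rewrite Hh0, Hg0.
  replace (w - (RtoC 0 + Cconj (RtoC 0)))%C with w by (apply C_eq; unfold Re, Im; simpl; ring).
  assert (Ef : forall z, Cmod z < 1 ->
     harm h g z = (PS (head2 1 a) z + Cconj (PS (head2 0 b) z))%C).
  { intros z Hz. unfold harm. destruct (E z Hz) as [-> ->]. auto. }
  apply (boundary_far (harm h g) (head2 1 a) (head2 0 b)); auto.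
  - intros z Hz. eapply Rlt_le_trans; [|apply Re_le_Cmod].
    apply (derivative_dominates gam del lam); auto.
  - intros eta Heta.
    destruct (extremal_limit gam del lam eta) as [rho [Hrho H]]; try lra.
    exists rho. split; [lra|]. intros z Hz. rewrite Ef by lra.
    eapply Rle_trans; [|apply (growth_lower_bound gam del lam); auto; lra].
    specialize (H _ Hz). apply Rabs_lt_between in H. lra.
Qed.

Lemma head2_series x a r : cv_disk (head2 x a) -> 0 <= r < 1 ->
  ex_series (fun k => Cmod (a (k + 2)%nat) * r ^ (k + 2)) /\
  Series (fun n => Cmod (head2 x a n) * r ^ n)
  = Cmod x * r + Series (fun k => Cmod (a (k + 2)%nat) * r ^ (k + 2)).
Proof.
  intros H Hr. specialize (H r Hr).
  assert (H1 := proj1 (ex_series_incr_1 (fun n => Cmod (head2 x a n) * r ^ n)) H).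
  assert (H2 := proj1 (ex_series_incr_1 (fun n => Cmod (head2 x a (S n)) * r ^ (S n))) H1).
  assert (E : forall n, Cmod (head2 x a (S (S n))) * r ^ (S (S n)) =
     Cmod (a (n + 2)%nat) * r ^ (n + 2)).
  { intros n. replace (n + 2)%nat with (S (S n)) by lia. auto. }
  split.
  - eapply ex_series_ext; [exact E|exact H2].
  - rewrite Series_incr_1, Series_incr_1 by auto. rewrite (Series_ext _ _ E).
    simpl. rewrite Cmod_0. ring.
Qed.

Lemma bohr_upper gam del lam h g a b z :
  0 <= lam < gam -> gam <= del -> RH0 gam del lam h g -> coefficients h g a b ->
  Cmod z < 1 ->
  Cmod (harm h g z) + Series_from2 (fun m => (Cmod (a m) + Cmod (b m)) * Cmod z ^ m)
  <= bohr_value gam del lam (Cmod z).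
Proof.
  intros Hl Hg HR Hab Hz. assert (Hg' : 0 < gam <= del) by lra.
  destruct (coef_class_of_RH0 _ _ _ _ _ _ _ HR Hab) as [Hcl E].
  assert (Hc := proj1 Hcl). assert (Hd := proj1 (proj2 Hcl)).
  pose proof (Cmod_ge_0 z) as Hz0. set (r := Cmod z) in *.
  assert (Hr : 0 <= r < 1) by lra.
  destruct (head2_series 1 a r Hc Hr) as [Xa Sa].
  destruct (head2_series 0 b r Hd Hr) as [Xb Sb].
  rewrite bohr_value_series by (auto; lra).
  unfold Series_from2.
  set (tot := Series _).
  assert (ES : tot = Series (fun k => Cmod (a (k + 2)%nat) * r ^ (k + 2))
                 + Series (fun k => Cmod (b (k + 2)%nat) * r ^ (k + 2))).
  { rewrite <- Series_plus by auto. apply Series_ext. intros; ring. }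
  assert (Hf : Cmod (harm h g z) <= r + tot).
  { unfold harm. destruct (E z Hz) as [-> ->].
    eapply Rle_trans; [apply Cmod_triangle|]. rewrite Cmod_conj.
    pose proof (PS_mod _ z Hc Hz) as P1. pose proof (PS_mod _ z Hd Hz) as P2.
    fold r in P1, P2. rewrite Sa, Cmod_1 in P1. rewrite Sb, Cmod_0 in P2. lra. }
  assert (HS : tot <= Series (fun k => extremal gam del lam (S k) * r ^ (k + 2))).
  { apply Series_le.
    - intros n. pose proof (pow_le r (n + 2) Hz0).
      pose proof (coefficient_bound gam del lam _ _ n Hg' Hcl) as B. simpl head2 in B.
      replace (n + 2)%nat with (S (S n)) in * by lia.
      pose proof (Cmod_ge_0 (a (S (S n)))).
      pose proof (Cmod_ge_0 (b (S (S n)))).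
      split; [apply Rmult_le_pos; lra|]. apply Rmult_le_compat_r; auto.
    - apply extremal_tail_summable; auto; lra. }
  lra.
Qed.

(** * The extremal function *)

Lemma is_series_zero : is_series (fun _ : nat => 0) 0.
Proof.
  assert (Hq : Rabs (1 / 2) < 1) by (rewrite Rabs_pos_eq; lra).
  assert (H := is_series_scal_l 0 _ _ (is_series_geom (1 / 2) Hq)).
  change (is_series (fun n => 0 * (1 / 2) ^ n) (0 * / (1 - 1 / 2))) in H.
  rewrite Rmult_0_l in H. apply is_series_ext with (2 := H). intros n. apply Rmult_0_l.
Qed.

Definition extremal_coef (gam del lam : R) (n : nat) : C :=
  match n with O => RtoC 0 | S k => RtoC (extremal gam del lam k) end.

Lemma extremal_coef_class gam del lam : 0 <= lam < gam -> gam <= del ->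
  coef_class gam del lam (extremal_coef gam del lam) (fun _ => RtoC 0).
Proof.
  intros Hl Hg. assert (Hg' : 0 < gam <= del) by lra.
  assert (H0 : cv_disk (fun _ => RtoC 0))
    by (apply bounded_cv_disk with 0; intros; rewrite Cmod_0; lra).
  assert (Hc : cv_disk (extremal_coef gam del lam))
    by (apply cv_disk_unshift; apply (extremal_cv gam del lam); lra).
  repeat split; auto. intros z Hz.
  rewrite (PS_ext (op_coef gam del (fun _ => RtoC 0)) (fun _ => RtoC 0))
    by (intros; unfold op_coef; ring).
  rewrite PS_zero, Cmod_0.
  assert (Hop := cv_disk_op_coef gam del _ Hc).
  assert (Hk := cv_disk_halfplane).
  assert (E : PS (op_coef gam del (extremal_coef gam del lam)) z
     = (RtoC lam + RtoC (gam - lam) * PS halfplane_coef z)%C).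
  { assert (En : forall n, op_coef gam del (extremal_coef gam del lam) n
      = (RtoC (gam - lam) * halfplane_coef n + match n with O => RtoC lam | _ => RtoC 0 end)%C).
    { intros n. unfold op_coef, extremal_coef. rewrite <- RtoC_mult, extremal_op by auto.
      rewrite RtoC_plus, RtoC_mult. destruct n; auto. }
    rewrite PS_shift, (PS_shift halfplane_coef) by auto.
    rewrite (PS_ext (fun n => op_coef gam del (extremal_coef gam del lam) (S n))
      (fun n => RtoC (gam - lam) * halfplane_coef (S n))%C)
      by (intros n; rewrite En; ring).
    rewrite (PS_scal_coef _ (fun n => halfplane_coef (S n))) by auto using cv_disk_shift.
    rewrite En. ring. }
  rewrite E, PS_halfplane by auto.
  pose proof (Re_cayley z Hz). pose proof (Cmod_ge_0 z).
  assert (0 < (1 - Cmod z) / (1 + Cmod z)) by (apply Rdiv_lt_0_compat; lra).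
  change (Re (RtoC lam + RtoC (gam - lam) * ((1 + z) / (1 - z)))%C) with
    (lam + Re (RtoC (gam - lam) * ((1 + z) / (1 - z)))%C).
  rewrite re_scal_l. 
  assert (0 < (gam - lam) * Re ((1 + z) / (1 - z))%C) by (apply Rmult_lt_0_compat; lra).
  lra.
Qed.

Definition extremal_fun (gam del lam : R) : C -> C := PS (extremal_coef gam del lam).

Lemma extremal_fun_eq gam del lam z : 0 <= lam < gam -> gam <= del -> Cmod z < 1 ->
  extremal_fun gam del lam z = (z * extremal_PS gam del lam z)%C.
Proof.
  intros Hl Hg Hz. unfold extremal_fun. rewrite PS_shift; auto.
  - unfold extremal_PS. simpl (extremal_coef gam del lam 0). rewrite Cplus_0_l. auto.
  - apply (extremal_coef_class gam del lam Hl Hg).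
Qed.

Lemma PS_at_0 c : cv_disk c -> PS c (RtoC 0) = c 0%nat.
Proof. intros Hc. rewrite PS_shift by (auto; rewrite Cmod_0; lra). ring. Qed.

Lemma extremal_fun_RH0 gam del lam : 0 <= lam < gam -> gam <= del ->
  RH0 gam del lam (extremal_fun gam del lam) (fun _ => RtoC 0).
Proof.
  intros Hl Hg. destruct (extremal_coef_class gam del lam Hl Hg) as (Hc & Hd & Hc1 & _ & Hpos).
  assert (Hz0 : Cmod (RtoC 0) < 1) by (rewrite Cmod_0; lra).
  assert (Hh0 := PS_at_0 _ Hc). assert (Hh1 := PS_at_0 _ (cv_disk_dcoef _ Hc)).
  split.
  - repeat split.
    + intros z Hz. eexists. apply PS_is_derive; auto.
    + intros z Hz. eexists. apply @is_derive_const.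
    + exact Hh0.
    + rewrite (C_derive_PS (extremal_fun gam del lam) _ Hc (fun _ _ => eq_refl) _ Hz0), Hh1.
      unfold dcoef. rewrite Hc1. apply C_eq; simpl; ring.
    + apply is_C_derive_unique. apply @is_derive_const.
  - intros z Hz. specialize (Hpos z Hz).
    rewrite (diff_op_PS gam del (extremal_fun gam del lam) _ Hc (fun _ _ => eq_refl) z Hz).
    rewrite (diff_op_PS gam del (fun _ => RtoC 0) _ Hd (fun x _ => eq_sym (PS_zero x)) z Hz).
    change (Re (PS (op_coef gam del (extremal_coef gam del lam)) z) + - lam
      > Cmod (PS (op_coef gam del (fun _ => RtoC 0)) z)). lra.
Qed.

Lemma extremal_fun_coefficients gam del lam : 0 <= lam < gam -> gam <= del ->
  coefficients (extremal_fun gam del lam) (fun _ => RtoC 0) (extremal_coef gam del lam) (fun _ => RtoC 0).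
Proof.
  intros Hl Hg. destruct (extremal_coef_class gam del lam Hl Hg) as (Hc & Hd & Hc1 & _).
  split; intros z Hz.
  - assert (Hs := cv_disk_summable _ z Hc Hz).
    destruct (CSeries_Csum _ 2 Hs) as [E1 E2].
    assert (E : forall n, (extremal_coef gam del lam (2 + n)%nat * z ^ (2 + n))%C
       = (extremal_coef gam del lam (n + 2)%nat * z ^ (n + 2))%C)
      by (intros n; rewrite (Nat.add_comm 2 n); auto).
    assert (E3 := CSeries_correct _ E2).
    apply (is_series_ext _ _ _ E) in E3.
    replace (extremal_fun gam del lam z - z)%C with
      (CSeries (fun n => extremal_coef gam del lam (2 + n)%nat * z ^ (2 + n))%C); auto.
    unfold extremal_fun, PS. rewrite E1. cbn [Csum]. rewrite Hc1.
    simpl (extremal_coef gam del lam 0). ring.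
  - apply is_series_C_iff. split; apply (is_series_ext (fun _ => 0));
      try exact is_series_zero; intros n; rewrite Cmult_0_l; auto.
Qed.

(** * Sharpness *)

Lemma disk_segment z1 z2 t : Cmod z1 < 1 -> Cmod z2 < 1 -> 0 <= t <= 1 ->
  Cmod (z1 + RtoC t * (z2 - z1)) < 1.
Proof.
  intros H1 H2 Ht.
  replace (z1 + RtoC t * (z2 - z1))%C with (RtoC (1 - t) * z1 + RtoC t * z2)%C
    by (rewrite RtoC_minus; ring).
  eapply Rle_lt_trans; [apply Cmod_triangle|].
  rewrite !Cmod_mult, !Cmod_R_nonneg by lra.
  assert (0 <= t * (1 - Cmod z2)) by (apply Rmult_le_pos; lra).
  destruct (Req_dec t 1) as [->|Hne]; [lra|].
  assert (0 < (1 - t) * (1 - Cmod z1)) by (apply Rmult_lt_0_compat; lra). lra.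
Qed.

Lemma PS_line_derive c k z v t : cv_disk c -> Cmod (z + RtoC t * v) < 1 ->
  is_derive (fun s => Re (k * PS c (z + RtoC s * v))%C) t
    (Re (k * (PS (dcoef c) (z + RtoC t * v) * v))%C).
Proof.
  intros Hc Hz. apply is_derive_Reals. intros eps Heps.
  set (z0 := (z + RtoC t * v)%C) in *. pose proof (Cmod_ge_0 z0).
  set (rho := (1 + Cmod z0) / 2).
  destruct (PS_second_order c rho Hc) as [M [HM H2]]; [unfold rho; lra|].
  pose proof (Cmod_ge_0 v) as Hv. pose proof (Cmod_ge_0 k) as Hk.
  set (B := Cmod k * M * Cmod v ^ 2 + 1).
  assert (HB : 0 < B).
  { unfold B. pose proof (pow2_ge_0 (Cmod v)).
    assert (0 <= Cmod k * M * Cmod v ^ 2) by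
      (apply Rmult_le_pos; [apply Rmult_le_pos; auto | auto]). lra. }
  assert (Hd : 0 < Rmin ((1 - Cmod z0) / (2 * (Cmod v + 1))) (eps / B)).
  { apply Rmin_pos; apply Rdiv_lt_0_compat; lra. }
  exists (mkposreal _ Hd). intros x Hx0 Hx. cbn [pos] in Hx.
  pose proof (Rmin_l ((1 - Cmod z0) / (2 * (Cmod v + 1))) (eps / B)) as L1.
  pose proof (Rmin_r ((1 - Cmod z0) / (2 * (Cmod v + 1))) (eps / B)) as L2.
  set (w := (RtoC x * v)%C).
  assert (Hw : Cmod w = Rabs x * Cmod v) by (unfold w; rewrite Cmod_mult, Cmod_R; auto).
  assert (Hxp : 0 < Rabs x) by (apply Rabs_pos_lt; auto).
  assert (Hin : Cmod (z0 + w) <= rho).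
  { pose proof (Cmod_triangle z0 w).
    assert (Rabs x * (Cmod v + 1) <= (1 - Cmod z0) / 2).
    { replace ((1 - Cmod z0) / 2) with
        ((1 - Cmod z0) / (2 * (Cmod v + 1)) * (Cmod v + 1)) by (field; lra).
      apply Rmult_le_compat_r; lra. }
    unfold rho. nra. }
  specialize (H2 z0 w ltac:(unfold rho; lra) Hin).
  replace (z + RtoC (t + x) * v)%C with (z0 + w)%C
    by (unfold z0, w; rewrite RtoC_plus; ring).
  set (e := (PS c (z0 + w) - PS c z0 - PS (dcoef c) z0 * w)%C) in *.
  replace ((Re (k * PS c (z0 + w))%C - Re (k * PS c z0)%C) / x
      - Re (k * (PS (dcoef c) z0 * v))%C) with (Re (k * e)%C / x).
  2:{ replace (k * PS c (z0 + w))%C with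
        (k * PS c z0 + (RtoC x * (k * (PS (dcoef c) z0 * v)) + k * e))%C
        by (unfold e, w; ring).
      set (A := (k * PS c z0)%C). set (D := (k * (PS (dcoef c) z0 * v))%C).
      set (F := (k * e)%C).
      change ((Re F) / x = (Re A + (Re (RtoC x * D)%C + Re F) - Re A) / x - Re D).
      rewrite re_scal_l. field. auto. }
  unfold Rdiv. rewrite Rabs_mult, Rabs_inv.
  apply Rmult_lt_reg_r with (Rabs x); auto.
  rewrite Rmult_assoc, Rinv_l, Rmult_1_r by lra.
  eapply Rle_lt_trans; [apply re_le_Cmod|]. rewrite Cmod_mult.
  apply Rle_lt_trans with (Cmod k * (M * Cmod w ^ 2)); [apply Rmult_le_compat_l; auto|].
  rewrite Hw.
  replace (Cmod k * (M * (Rabs x * Cmod v) ^ 2)) with ((B - 1) * Rabs x * Rabs x)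
    by (unfold B; ring).
  apply Rmult_lt_compat_r; auto.
  assert (Rabs x * B < eps).
  { replace eps with (eps / B * B) by (field; lra). apply Rmult_lt_compat_r; lra. }
  lra.
Qed.

(** The Noshiro-Warschawski argument: a derivative of positive real part makes
    the function strictly monotone along every chord of the disk. *)
Lemma noshiro_warschawski c z1 z2 : cv_disk c ->
  (forall z, Cmod z < 1 -> 0 < Re (PS (dcoef c) z)) ->
  Cmod z1 < 1 -> Cmod z2 < 1 -> z1 <> z2 ->
  0 < Re (Cconj (z2 - z1) * (PS c z2 - PS c z1))%C.
Proof.
  intros Hc Hpos H1 H2 Hne. set (v := (z2 - z1)%C).
  assert (Hv : 0 < Cmod v).
  { apply Cmod_gt_0. intros E. apply Hne.
    replace z2 with (z1 + v)%C by (unfold v; ring). rewrite E; ring. }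
  set (phi := fun s => Re (Cconj v * PS c (z1 + RtoC s * v))%C).
  assert (D : forall t, 0 <= t <= 1 ->
    is_derive phi t (Re (Cconj v * (PS (dcoef c) (z1 + RtoC t * v) * v))%C)).
  { intros t Ht. apply PS_line_derive; auto. apply disk_segment; auto. }
  destruct (MVT_gen phi 0 1
    (fun t => Re (Cconj v * (PS (dcoef c) (z1 + RtoC t * v) * v))%C)) as [t [Ht E]].
  - rewrite Rmin_left, Rmax_right by lra. intros; apply D; lra.
  - rewrite Rmin_left, Rmax_right by lra. intros x Hx.
    apply derivable_continuous_pt, ex_derive_Reals_0. eexists; apply D; lra.
  - rewrite Rmin_left, Rmax_right in Ht by lra.
    assert (Hp := Hpos _ (disk_segment z1 z2 t H1 H2 Ht)). fold v in Hp.
    set (p := PS (dcoef c) (z1 + RtoC t * v)) in *.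
    replace (Cconj v * (p * v))%C with (RtoC (Cmod v ^ 2) * p)%C in E
      by (rewrite Cmod2_conj; ring).
    rewrite re_scal_l in E. unfold phi in E.
    replace (z1 + RtoC 1 * v)%C with z2 in E by (unfold v; ring).
    replace (z1 + RtoC 0 * v)%C with z1 in E by ring.
    replace (Cconj v * (PS c z2 - PS c z1))%C
      with (Cconj v * PS c z2 - Cconj v * PS c z1)%C by ring.
    change (0 < Re (Cconj v * PS c z2)%C - Re (Cconj v * PS c z1)%C). rewrite E.
    assert (0 < Cmod v ^ 2) by (apply pow_lt; auto). nra.
Qed.

Lemma PS_real_Im c x : (forall n, Im (c n) = 0) -> Im (PS c (RtoC x)) = 0.
Proof.
  intros H. unfold PS, CSeries. simpl.
  rewrite (Series_ext _ (fun n => 0 * 0)); [rewrite Series_scal_l; ring|].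
  intros n. rewrite <- RtoC_pow.
  change (Re (c n) * 0 + Im (c n) * x ^ n = 0 * 0). rewrite H. ring.
Qed.

(** The extremal function takes real values only on the real axis, where it
    increases from its limit [- d*] at [- 1]. *)
Lemma extremal_fun_omits gam del lam : 0 <= lam < gam -> gam <= del ->
  forall z, Cmod z < 1 -> extremal_fun gam del lam z <> RtoC (- extremal_dist gam del lam).
Proof.
  intros Hl Hg z Hz E. assert (Hg' : 0 < gam <= del) by lra.
  assert (Hcl := extremal_coef_class gam del lam Hl Hg). assert (Hc := proj1 Hcl).
  set (D := extremal_dist gam del lam) in *.
  assert (Hpos : forall z, Cmod z < 1 -> 0 < Re (PS (dcoef (extremal_coef gam del lam)) z)).
  { intros y Hy. eapply Rle_lt_trans; [apply Cmod_ge_0|].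
    apply (derivative_dominates gam del lam _ _ y Hg' Hl Hcl Hy). }
  assert (NW := fun z1 z2 => noshiro_warschawski _ z1 z2 Hc Hpos).
  fold (extremal_fun gam del lam) in NW.
  assert (Hreal : forall x, Im (extremal_fun gam del lam (RtoC x)) = 0).
  { intros x. apply PS_real_Im. intros [|n]; auto. }
  destruct z as [x y].
  assert (Hx : Cmod (RtoC x) < 1).
  { rewrite Cmod_R. pose proof (re_le_Cmod (x, y)). simpl in H. lra. }
  assert (Hy : y = 0).
  { apply NNPP. intros Hy. specialize (NW (RtoC x) (x, y) Hx Hz).
    assert (Hne : RtoC x <> (x, y)) by (intros F; apply (f_equal Im) in F; simpl in F; auto).
    specialize (NW Hne). rewrite E in NW. specialize (Hreal x).
    destruct (extremal_fun gam del lam (RtoC x)) as [p q]. simpl in Hreal. subst q.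
    simpl in NW. unfold Re in NW; simpl in NW. nra. }
  subst y. change (x, 0) with (RtoC x) in *.
  assert (Hmono : forall s t, -1 < s -> s < t -> t < 1 ->
     Re (extremal_fun gam del lam (RtoC s)) < Re (extremal_fun gam del lam (RtoC t))).
  { intros s t Hs Hst Ht.
    assert (Hs1 : Cmod (RtoC s) < 1) by (rewrite Cmod_R; apply Rabs_lt_between; lra).
    assert (Ht1 : Cmod (RtoC t) < 1) by (rewrite Cmod_R; apply Rabs_lt_between; lra).
    assert (Hne : RtoC s <> RtoC t) by (intros F; apply RtoC_inj in F; lra).
    specialize (NW _ _ Hs1 Ht1 Hne).
    destruct (extremal_fun gam del lam (RtoC s)) as [p q]. destruct (extremal_fun gam del lam (RtoC t)) as [p' q'].
    simpl in NW |- *. unfold Re in NW; simpl in NW. nra. }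
  rewrite Cmod_R in Hx. apply Rabs_lt_between in Hx.
  set (x' := (x - 1) / 2). assert (Hx' : -1 < x' < x) by (unfold x'; lra).
  assert (Hlt := Hmono x' x ltac:(lra) ltac:(lra) ltac:(lra)). rewrite E in Hlt.
  change (Re (extremal_fun gam del lam (RtoC x')) < - D) in Hlt.
  destruct (extremal_limit gam del lam (- D - Re (extremal_fun gam del lam (RtoC x')))) as [rho [Hrho H]];
    auto; try lra. 
  set (r := Rmax rho ((1 - x') / 2)).
  assert (Hr1 : rho <= r) by apply Rmax_l. assert (Hr2 : (1 - x') / 2 <= r) by apply Rmax_r.
  assert (Hr3 : r < 1) by (apply Rmax_lub_lt; lra).
  specialize (H r ltac:(lra)).
  assert (Hlt2 := Hmono (- r) x' ltac:(lra) ltac:(lra) ltac:(lra)).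
  assert (Hh : Re (extremal_fun gam del lam (RtoC (- r)))
    = - (r * Re (extremal_PS gam del lam (RtoC (- r))))).
  { rewrite extremal_fun_eq; auto.
    - rewrite re_scal_l. ring.
    - rewrite Cmod_R. apply Rabs_lt_between; lra. }
  rewrite Hh in Hlt2. fold D in H. apply Rabs_lt_between in H. lra.
Qed.

(** An omitted limit of values lies on the boundary. *)
Lemma extremal_fun_boundary gam del lam : 0 <= lam < gam -> gam <= del ->
  boundary (image_disk (harm (extremal_fun gam del lam) (fun _ => RtoC 0)))
    (RtoC (- extremal_dist gam del lam)).
Proof.
  intros Hl Hg. assert (Hg' : 0 < gam <= del) by lra.
  assert (Hharm : forall z, harm (extremal_fun gam del lam) (fun _ => RtoC 0) z = extremal_fun gam del lam z).
  { intros z. unfold harm. apply C_eq; simpl; unfold Re, Im; ring. }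
  split; intros H; apply locally_C_iff in H as [delta [Hd H]].
  - destruct (extremal_limit gam del lam delta) as [rho [Hrho HL]]; auto; try lra.
    specialize (HL rho ltac:(lra)).
    assert (Hin : Cmod (RtoC (- rho)) < 1) by (rewrite Cmod_R; apply Rabs_lt_between; lra).
    apply (H (extremal_fun gam del lam (RtoC (- rho)))).
    + rewrite extremal_fun_eq by auto.
      assert (Him : Im (extremal_PS gam del lam (RtoC (- rho))) = 0)
        by (apply PS_real_Im; auto).
      destruct (extremal_PS gam del lam (RtoC (- rho))) as [p q]. simpl in Him, HL. subst q.
      replace (RtoC (- rho) * (p, 0) - RtoC (- extremal_dist gam del lam))%C
        with (RtoC (- (rho * p - extremal_dist gam del lam))).
      * rewrite Cmod_R, Rabs_Ropp. exact HL.
      * apply C_eq; simpl; ring.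
    + exists (RtoC (- rho)). split; auto.
  - destruct (H (RtoC (- extremal_dist gam del lam))) as [z [Hz E]].
    { replace (RtoC (- extremal_dist gam del lam) - RtoC (- extremal_dist gam del lam))%C
        with (RtoC 0) by ring. rewrite Cmod_0; auto. }
    rewrite Hharm in E. apply (extremal_fun_omits gam del lam Hl Hg z Hz). auto.
Qed.

Lemma extremal_fun_bohr_value gam del lam r : 0 <= lam < gam -> gam <= del -> 0 <= r < 1 ->
  Cmod (harm (extremal_fun gam del lam) (fun _ => RtoC 0) (RtoC r))
  + Series_from2 (fun m => (Cmod (extremal_coef gam del lam m) + Cmod (RtoC 0))
      * Cmod (RtoC r) ^ m)
  = bohr_value gam del lam r.
Proof.
  intros Hl Hg Hr. assert (Hg' : 0 < gam <= del) by lra.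
  assert (Hz : Cmod (RtoC r) < 1) by (rewrite Cmod_R_nonneg; lra).
  rewrite (Cmod_R_nonneg r) by lra.
  assert (ES : Series_from2 (fun m => (Cmod (extremal_coef gam del lam m) + Cmod (RtoC 0)) * r ^ m)
     = Series (fun k => extremal gam del lam (S k) * r ^ (k + 2))).
  { apply Series_ext. intros n. rewrite Cmod_0, Rplus_0_r.
    f_equal. replace (n + 2)%nat with (S (S n)) by lia.
    cbn [extremal_coef]. apply Cmod_R_nonneg. apply Rlt_le, extremal_pos; auto; lra. }
  rewrite ES.
  assert (EP : Re (extremal_PS gam del lam (RtoC r)) = PSeries (extremal gam del lam) r)
    by (unfold extremal_PS; rewrite Re_PS_real; auto).
  assert (Him : Im (extremal_PS gam del lam (RtoC r)) = 0) by (apply PS_real_Im; auto).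
  assert (EV := bohr_value_series gam del lam r (proj2 Hl) Hg' Hr).
  assert (Hn : 0 <= Series (fun k => extremal gam del lam (S k) * r ^ (k + 2))).
  { apply Series_nonneg; [|apply extremal_tail_summable; auto; lra].
    intros n. apply Rmult_le_pos; [apply Rlt_le, extremal_pos; auto; lra|apply pow_le; lra]. }
  replace (harm (extremal_fun gam del lam) (fun _ => RtoC 0) (RtoC r))
    with (RtoC (r * PSeries (extremal gam del lam) r)).
  - unfold bohr_value in *. rewrite Cmod_R_nonneg; lra.
  - unfold harm. rewrite extremal_fun_eq by auto. rewrite <- EP.
    destruct (extremal_PS gam del lam (RtoC r)) as [p q]. simpl in Him. subst q.
    apply C_eq; simpl; ring.
Qed.

Theorem theorem3p4 (gam del lam : R)
  (hlam : 0 <= lam) (hlg : lam < gam) (hgd : gam <= del) :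
  exists R1 : R,
    (0 < R1 < 1 /\ radius_equation gam del lam R1) /\
    (forall r : R, 0 < r < 1 -> radius_equation gam del lam r -> r = R1) /\
    bohr_holds_upto gam del lam R1 /\
    (forall rho : R, R1 < rho -> ~ bohr_holds_upto gam del lam rho).
Proof.
  assert (Hl : 0 <= lam < gam) by lra. assert (Hg : 0 < gam <= del) by lra.
  destruct (radius_exists gam del lam Hl Hg) as [R1 [HR1 E1]].
  assert (Mono := fun r s => bohr_value_increasing gam del lam r s hlg Hg).
  exists R1. split; [|split; [|split]].
  - split; auto. apply radius_equation_iff; auto; lra.
  - intros r Hr E. apply radius_equation_iff in E; auto; [|lra].
    destruct (Rtotal_order r R1) as [H|[H|H]]; auto; exfalso.
    + specialize (Mono r R1 ltac:(lra) H ltac:(lra)). lra.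
    + specialize (Mono R1 r ltac:(lra) H ltac:(lra)). lra.
  - intros h g a b HRH Hab z Hz HzR. unfold in_disk in Hz.
    unfold bohr_inequality.
    eapply Rbar_le_trans; [|exact (dist_lower_bound gam del lam h g a b Hl hgd HRH Hab)].
    simpl. eapply Rle_trans; [apply (bohr_upper gam del lam h g a b z Hl hgd HRH Hab Hz)|].
    rewrite <- E1. destruct HzR as [HzR|HzR]; [|rewrite HzR; lra].
    apply Rlt_le, Mono; auto; [apply Cmod_ge_0|lra].
  - intros rho Hrho Hb.
    set (r := Rmin ((R1 + 1) / 2) rho).
    assert (Hr1 : r <= (R1 + 1) / 2) by apply Rmin_l.
    assert (Hr2 : r <= rho) by apply Rmin_r.
    assert (Hr3 : R1 < r) by (apply Rmin_glb_lt; lra).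
    assert (Hz : Cmod (RtoC r) = r) by (apply Cmod_R_nonneg; lra).
    specialize (Hb _ _ _ _ (extremal_fun_RH0 gam del lam Hl hgd) (extremal_fun_coefficients gam del lam Hl hgd)
       (RtoC r)). unfold in_disk in Hb. rewrite Hz in Hb. specialize (Hb ltac:(lra) Hr2).
    unfold bohr_inequality in Hb. rewrite extremal_fun_bohr_value in Hb by (auto; lra).
    assert (Hd : Rbar_le (dist_to (harm (extremal_fun gam del lam) (fun _ => RtoC 0) (RtoC 0))
       (boundary (image_disk (harm (extremal_fun gam del lam) (fun _ => RtoC 0)))))
       (extremal_dist gam del lam)).
    { apply (proj1 (Glb_Rbar_correct _)).
      exists (RtoC (- extremal_dist gam del lam)). split; [apply extremal_fun_boundary; auto|].
      destruct (extremal_fun_RH0 gam del lam Hl hgd) as [(_ & _ & H0 & _) _].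
      unfold harm. rewrite H0.
      replace (RtoC (- extremal_dist gam del lam) - (RtoC 0 + Cconj (RtoC 0)))%C
        with (RtoC (- extremal_dist gam del lam)) by (apply C_eq; simpl; ring).
      rewrite Cmod_R, Rabs_Ropp, Rabs_pos_eq; auto.
      apply Rlt_le, extremal_dist_bounds; auto. }
    assert (Hc := Rbar_le_trans _ _ _ Hb Hd). simpl in Hc.
    specialize (Mono R1 r ltac:(lra) Hr3 ltac:(lra)). lra.
Qed.
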